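(* Consider $N$ agents, the behavior system (leader), and the communication graph described in the context. Suppose that: (A1) the communication graph $\mathcal{G}$ is connected; (A2) $n_i^x\le n_0^w$ for every $i\in\{1,\dots,N\}$; (A3) for every $i\in\{1,\dots,N\}$ there is a constant $M>0$ such that $|g_i(z_i+\Delta,x_i)-g_i(z_i,x_i)|\le M\|\Delta\|$ for all $z_i,\Delta\in\mathbb{R}^{n_i^z}$ and $x_i\in\mathbb{R}^{n_i^x}$. Let $P\in\mathbb{R}^{n_0^w\times n_0^w}$ be a symmetric positive definite matrix satisfying $S^{\top}P+PS<2Pdd^{\top}P$, and let $K=-\gamma d^{\top}P$ with $\gamma\ge\frac{1}{\lambda_N}$, where $\lambda_N>0$ is the smallest eigenvalue of the matrix $H$ defined in the context. Then the coordination problem is solved by the following reduced-order control law, for $i=1,\dots,N$: $$ \begin{aligned} u_i&=-g_i(\xi_i,x_i)+x_{i(n_i^x+1)},\\ \dot{x}_{ij}&=x_{i(j+1)},\qquad j=n_i^x+1,\dots,n_0^w-1,\\ \dot{x}_{in_0^w}&=\sum_{j=1}^{n_0^w}s_j^0x_{ij}+d_{n_0^w}v+d_{n_0^w}K\sum_{j=0}^{N}a_{ij}(\hat x_i-\hat x_j),\\ \dot{\xi}_i&=A_i^0\xi_i+f_i(x_i), \end{aligned} $$ where $\hat x_0=w$ and $\hat x_i=\mathrm{col}(x_{i1},\dots,x_{in_0^w})$ for $i\ge1$, and where $\xi_i\in\mathbb{R}^{n_i^z}$ and $x_{i(n_i^x+1)},\dots,x_{in_0^w}\in\mathbb{R}$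 are the controller states. If $n_i^x=n_0^w$, there are no additional states $x_{ij}$ with $j>n_i^x$, and $x_{i(n_i^x+1)}$ in the formula for $u_i$ is replaced by $\sum_{j=1}^{n_0^w}s_j^0x_{ij}+d_{n_0^w}v+d_{n_0^w}K\sum_{j=0}^{N}a_{ij}(\hat x_i-\hat x_j)$.
   Context: **Notation.** $\mathrm{col}(a_1,\dots,a_n)=[a_1^{\top},\dots,a_n^{\top}]^{\top}$. For symmetric matrices, $A<B$ means that $B-A$ is positive definite. A matrix is Hurwitz if all its eigenvalues have negative real part. **Agents.** For $i=1,\dots,N$, agent $i$ has dynamics $$\dot z_i=A_i^0z_i+f_i(x_i),\quad \dot x_{i1}=x_{i2},\ \dots,\ \dot x_{i(n_i^x-1)}=x_{in_i^x},\quad \dot x_{in_i^x}=u_i+g_i(z_i,x_i),\quad y_i=x_{i1},$$ with $z_i\in\mathbb{R}^{n_i^z}$, $x_i=\mathrm{col}(x_{i1},\dots,x_{in_i^x})\in\mathbb{R}^{n_i^x}$, $n_i^x\ge1$, and input and output $u_i,y_i\in\mathbb{R}$. The matrix $A_i^0$ is Hurwitz, and $f_i,g_i$ are infinitely differentiable. (The high-frequency gain, a positive constant multiplying $u_i$, is normalized to $1$ throughout.) **Behavior system (leader, agent 0).** $\dot w=Sw+dv(t)$, $y_r=c^{\top}w$, with $w\in\mathbb{R}^{n_0^w}$ and $y_r,v(t)\in\mathbb{R}$, where $v$ is continuous in $t$ and $|v(t)|\le l$ for some positive constant $l$. The system is minimal with no zero dynamics and is written in the coordinates where $S$ is the companion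 matrix with ones on the superdiagonal, last row $(s_1^0,s_2^0,\dots,s_{n_0^w}^0)$, and all other entries zero; $d=\mathrm{col}(0,\dots,0,d_{n_0^w})$ with $d_{n_0^w}\neq0$; and $c=\mathrm{col}(1,0,\dots,0)$. **Communication graph.** $\mathcal{G}$ is a weighted digraph on nodes $\{0,1,\dots,N\}$ (node $0$ is the leader) with weights $a_{ij}\ge0$ and $a_{ii}=0$; $a_{ij}>0$ if and only if there is an edge from $j$ to $i$, i.e. agent $i$ can use information of agent $j$. Also $a_{0i}=0$ for $i=1,\dots,N$. $\mathcal{G}$ is called connected if there is a directed path from node $0$ to every other node and the subgraph induced on $\{1,\dots,N\}$ is undirected ($a_{ij}=a_{ji}$ for $i,j\ge1$). The Laplacian $L=[l_{ij}]$ has $l_{ii}=\sum_{j\ne i}a_{ij}$ and $l_{ij}=-a_{ij}$ for $j\ne i$. $H\in\mathbb{R}^{N\times N}$ is obtained from $L$ by deleting the row and column of node $0$. When $\mathcal{G}$ is connected, $H$ is symmetric positive definite, with eigenvalues $\lambda_1\ge\dots\ge\lambda_N>0$. **Coordination problem.** A control law, with controller states collected in a vector $x_i^c$ for each agent $i$, solves the coordination problem if, for every real-valued input $v$ of the behavior system that is continuous in $t$ and satisfies $|v(t)|\le l$ for all $t$ for some positive constant $l$, and every initial condition of $z_i,x_i,x_i^c$ ($i=1,\dots,N$) and $w$, the tracking errors $e_i=y_i-y_r$ of the resulting composite system satisfy $\lim_{t\to+\infty}e_i(t)=0$ for all $i\in\{1,\dots,N\}$. *)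

(* Defs.v *)
From HB Require Import structures.
From mathcomp Require Import all_boot all_order all_algebra.
From mathcomp Require Import all_classical all_reals all_analysis.
From mathcomp.real_closed Require Import complex.
Set Implicit Arguments.
Unset Strict Implicit.
Unset Printing Implicit Defensive.
Import Order.TTheory GRing.Theory Num.Theory.
Import numFieldNormedType.Exports.
Local Open Scope classical_set_scope.
Local Open Scope ring_scope.

Definition posdef (R : realType) n (A : 'M[R]_n) : Prop :=
  A^T = A /\ forall x : 'cV[R]_n, x != 0 -> 0 < (x^T *m A *m x) 0 0.

(* [map_mx (real_complex R) A] is A viewed as a complex matrix. *)
Definition hurwitz (R : realType) n (A : 'M[R]_n) : Prop :=
  forall lambda : R[i],
    eigenvalue (map_mx (real_complex R) A) lambda -> complex.Re lambda < 0.

Definition smallest_eigenvalue (R : realType) n (A : 'M[R]_n) (lambda : R)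
    : Prop :=
  eigenvalue A lambda /\ forall mu : R, eigenvalue A mu -> lambda <= mu.

(* The norm that MathComp-Analysis puts on matrices is the max norm. *)
Definition enorm (R : realType) n (x : 'cV[R]_n) : R :=
  Num.sqrt (\sum_(k < n) x k 0 ^+ 2).

(* In finite dimension, f is of class C^(k+1) iff it is differentiable and
   all its directional derivatives are of class C^k. *)
Fixpoint class_C (R : realType) (U V : normedModType R) (k : nat)
    (f : U -> V) : Prop :=
  match k with
  | 0 => continuous f
  | k'.+1 => (forall x, differentiable f x) /\
             forall v : U, class_C k' (fun x => 'D_v f x)
  end.

Definition smooth (R : realType) (U V : normedModType R) (f : U -> V) : Prop :=
  forall k, class_C k f.

(* j-th coordinate with a natural-number index; indices start at 0. *)
Definition ent (R : realType) n (x : 'cV[R]_n) (j : nat) : R :=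
  oapp (fun k => x k 0) 0 (insub j).

(* Solutions live on [0, +oo[.  Since y is continuous at 0 from the right, for
   a right-hand side continuous on [0, +oo[ the equation then also holds at
   t = 0 for the right derivative. *)
Definition solves_ode (R : realType) n (y rhs : R -> 'cV[R]_n) : Prop :=
  {within `[0, +oo[, continuous y} /\
  forall t : R, 0 < t -> is_derive t 1 y (rhs t).

Record agent (R : realType) := Agent {
  nz : nat;
  nx : nat;
  A0 : 'M[R]_nz;
  f : 'cV[R]_nx -> 'cV[R]_nz;
  g : 'cV[R]_nz -> 'cV[R]_nx -> R }.

Definition agent_wf (R : realType) (a : agent R) : Prop :=
  [/\ (1 <= nx a)%N, hurwitz (A0 a), smooth (@f R a) &
      smooth (fun p : 'cV[R]_(nz a) * 'cV[R]_(nx a) => g p.1 p.2)].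

Definition g_lipschitz (R : realType) (a : agent R) : Prop :=
  exists2 M : R, 0 < M &
    forall (z Delta : 'cV[R]_(nz a)) (x : 'cV[R]_(nx a)),
      `|g (z + Delta) x - g z x| <= M * enorm Delta.

Definition z_field (R : realType) (a : agent R)
    (z : 'cV[R]_(nz a)) (x : 'cV[R]_(nx a)) : 'cV[R]_(nz a) :=
  A0 a *m z + f x.

Definition x_field (R : realType) (a : agent R)
    (z : 'cV[R]_(nz a)) (x : 'cV[R]_(nx a)) (u : R) : 'cV[R]_(nx a) :=
  \col_(j < nx a) (if (j.+1 < nx a)%N then ent x j.+1 else u + g z x).

Definition agent_output (R : realType) (a : agent R) (x : 'cV[R]_(nx a)) : R :=
  ent x 0.

(* The coefficients s_j^0 of the last row of S are the entries of s. *)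
Definition leader_S (R : realType) n0 (s : 'rV[R]_n0) : 'M[R]_n0 :=
  \matrix_(i < n0, j < n0)
    (if i.+1 == n0 :> nat then s 0 j else (j == i.+1 :> nat)%:R).

Definition leader_d (R : realType) n0 (d0 : R) : 'cV[R]_n0 :=
  \col_(j < n0) (if j.+1 == n0 :> nat then d0 else 0).

Definition leader_c (R : realType) n0 : 'cV[R]_n0 :=
  \col_(j < n0) (j == 0%N :> nat)%:R.

Definition leader_field (R : realType) n0 (s : 'rV[R]_n0) (d0 : R)
    (w : 'cV[R]_n0) (v : R) : 'cV[R]_n0 :=
  leader_S s *m w + v *: leader_d n0 d0.

Definition leader_output (R : realType) n0 (w : 'cV[R]_n0) : R :=
  ((leader_c R n0)^T *m w) 0 0.

(* Node 0 is the leader; agent i : 'I_N is node [lift ord0 i] : 'I_N.+1. *)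
Definition comm_graph (R : realType) N (a : 'M[R]_N.+1) : Prop :=
  [/\ forall i j, 0 <= a i j, forall i, a i i = 0 &
      forall i, i != ord0 -> a ord0 i = 0].

Definition edge (R : realType) N (a : 'M[R]_N.+1) : rel 'I_N.+1 :=
  fun j i => 0 < a i j.

Definition graph_connected (R : realType) N (a : 'M[R]_N.+1) : Prop :=
  (forall i, connect (edge a) ord0 i) /\
  (forall i j, i != ord0 -> j != ord0 -> a i j = a j i).

Definition laplacian (R : realType) N (a : 'M[R]_N.+1) : 'M[R]_N.+1 :=
  \matrix_(i, j) (if i == j then \sum_(k | k != i) a i k else - a i j).

Definition graph_H (R : realType) N (a : 'M[R]_N.+1) : 'M[R]_N :=
  row' ord0 (col' ord0 (laplacian a)).

Section Coordination.
Variables (R : realType) (N : nat) (ag : 'I_N -> agent R).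
Variables (n0 : nat) (s : 'rV[R]_n0) (d0 : R).

(* State of the composite system, with controller states of dimension nc i. *)
Record composite_state (nc : 'I_N -> nat) := CompositeState {
  st_z : forall i, 'cV[R]_(nz (ag i));
  st_x : forall i, 'cV[R]_(nx (ag i));
  st_c : forall i, 'cV[R]_(nc i);
  st_w : 'cV[R]_n0 }.

Record control_law := ControlLaw {
  nc : 'I_N -> nat;
  law_u : 'I_N -> R -> composite_state nc -> R;
  law_c : forall i : 'I_N, R -> composite_state nc -> 'cV[R]_(nc i) }.

Definition composite_trajectory (law : control_law) (v : R -> R)
    (X : R -> composite_state (nc law)) : Prop :=
  [/\ forall i, solves_ode (fun t => st_z (X t) i)
        (fun t => z_field (st_z (X t) i) (st_x (X t) i)),
      forall i, solves_ode (fun t => st_x (X t) i)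
        (fun t => x_field (st_z (X t) i) (st_x (X t) i) (law_u i (v t) (X t))),
      forall i, solves_ode (fun t => st_c (X t) i)
        (fun t => law_c i (v t) (X t)) &
      solves_ode (fun t => st_w (X t))
        (fun t => leader_field s d0 (st_w (X t)) (v t))].

Definition tracking_error nc (X : composite_state nc) (i : 'I_N) : R :=
  agent_output (st_x X i) - leader_output (st_w X).

(* A law under which some initial condition has no solution on the whole of
   [0, +oo[ (finite escape time) does not solve the problem. *)
Definition solves_coordination (law : control_law) : Prop :=
  forall v : R -> R,
    {within `[0, +oo[, continuous v} ->
    (exists2 l : R, 0 < l & forall t, 0 <= t -> `|v t| <= l) ->
  forall X0 : composite_state (nc law),
    (exists X, composite_trajectory v X /\ X 0 = X0) /\
    (forall X, composite_trajectory v X -> X 0 = X0 ->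
       forall i, tracking_error (X t) i @[t --> +oo] --> (0 : R)).

Section ReducedOrder.
Variables (a : 'M[R]_N.+1) (K : 'rV[R]_n0).

(* The controller state of agent i stacks xi_i and the extra coordinates
   x_ij, nx < j <= n0. *)
Definition red_nc (i : 'I_N) : nat := (nz (ag i) + (n0 - nx (ag i)))%N.

Definition red_xi (X : composite_state red_nc) (i : 'I_N)
    : 'cV[R]_(nz (ag i)) := usubmx (st_c X i).

(* When nx <= n0, this is exactly the stack of the two blocks. *)
Definition red_xhat (X : composite_state red_nc) (i : 'I_N) : 'cV[R]_n0 :=
  \col_(j < n0) ent (col_mx (st_x X i) (dsubmx (st_c X i))) j.

Definition node_xhat (X : composite_state red_nc) (j : 'I_N.+1) : 'cV[R]_n0 :=
  oapp (red_xhat X) (st_w X) (unlift ord0 j).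

Definition red_top (i : 'I_N) (v : R) (X : composite_state red_nc) : R :=
  \sum_(j < n0) s 0 j * red_xhat X i j 0 + d0 * v
  + d0 * (K *m \sum_(j < N.+1)
                 a (lift ord0 i) j *: (red_xhat X i - node_xhat X j)) 0 0.

Definition red_next (i : 'I_N) (v : R) (X : composite_state red_nc) (j : nat)
    : R :=
  if (j < n0)%N then ent (red_xhat X i) j else red_top i v X.

Definition red_u (i : 'I_N) (v : R) (X : composite_state red_nc) : R :=
  - g (red_xi X i) (st_x X i) + red_next i v X (nx (ag i)).

Definition red_c (i : 'I_N) (v : R) (X : composite_state red_nc)
    : 'cV[R]_(red_nc i) :=
  col_mx (z_field (red_xi X i) (st_x X i))
         (\col_(k < (n0 - nx (ag i))%N) red_next i v X (nx (ag i) + k).+1%N).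

Definition reduced_order_law : control_law := ControlLaw red_u red_c.

End ReducedOrder.
End Coordination.

(* Main.v *)
Require Import Defs.
From HB Require Import structures.
From mathcomp Require Import all_boot all_order all_algebra.
From mathcomp Require Import all_classical all_reals all_analysis.
From mathcomp.real_closed Require Import complex.
From mathcomp Require Import ring lra.
Import Order.TTheory GRing.Theory Num.Theory.
Import numFieldNormedType.Exports.
Local Open Scope classical_set_scope.
Local Open Scope ring_scope.
Set Implicit Arguments.
Unset Strict Implicit.
Unset Printing Implicit Defensive.

(** The observer errors eps_i = z_i - xi_i satisfy eps_i' = A_i^0 eps_i, hence
tend to 0 by Cayley-Hamilton: peeling off one factor (A - lambda) of the
characteristic polynomial at a time reduces the claim to scalar equations
y' = lambda y + r with Re lambda < 0 and r -> 0.  The consensus errors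
delta_i = xhat_i - w satisfy
  delta_i' = S delta_i + d K sum_j H_ij delta_j + b_i beta_i,
where beta_i = g_i(z_i, x_i) - g_i(xi_i, x_i) is O(eps_i) by (A3).  For
V = sum_i delta_i^T P delta_i, the Rayleigh bound H >= lambda_N and
gamma lambda_N >= 1 give V' <= - c V + O(sum_i beta_i^2) without diagonalizing
H, so V -> 0.

In the coordinates (w, eps, xhat, xi) the closed loop is a cascade: the first
three blocks grow at most linearly whatever xi is, and xi is then driven
linearly.  All Picard iterates thus stay below an explicit exponential on
every [0, T], so they converge although the nonlinearities are only locally
Lipschitz. *)

(** * Comparison principle *)

(** The law cancels g_i(z_i, x_i) by its estimate g_i(xi_i, x_i), so xhat_i copies the leader up to
    the coupling and to the disturbance beta_i in coordinate n_i^x alone; v enters xhat_i and w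
    alike and drops out of delta_i. All agents share P, d and K, hence the coupling reaches V' only
    through the scalars eta_i = delta_i^T P d: the matrix inequality for P leaves 2 sum_i eta_i^2,
    and the feedback contributes -2 gamma eta^T H eta, which outweighs it. Connectedness enters
    through lambda_N > 0.

    The obstacle to existence is that f_i may grow arbitrarily fast and that g_i is globally
    Lipschitz in z only. In the coordinates (z, xi) both blocks would be driven by f_i; in eps this
    term cancels, and the constant of (A3), uniform in x, makes beta_i at most linear in eps_i. What
    remains of f_i acts on xi as an input that is already bounded on [0, T]. *)

(** The mean value theorem for [g - f]. Derivatives are required only inside the interval because
    primitives and trajectories are differentiated only at positive times, while intervals may start
    at 0. *)
Lemma is_derive_increment_le (R : realType) (f g f' g' : R -> R) (a b : R) :
  a <= b ->
  {within `[a, b], continuous f} -> {within `[a, b], continuous g} ->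
  (forall t : R, a < t < b -> is_derive t 1 f (f' t)) ->
  (forall t : R, a < t < b -> is_derive t 1 g (g' t)) ->
  (forall t, a < t < b -> f' t <= g' t) ->
  f b - f a <= g b - g a.
Proof.
rewrite le_eqVlt => /predU1P[<- *|ab cf cg df dg fg]; first by rewrite !subrr.
have cgf : {within `[a, b], continuous (g - f)}.
  by move=> x; apply: cvgB; [exact: cg|exact: cf].
have dgf t : t \in `]a, b[ -> is_derive t 1 (g - f) (g' t - f' t).
  rewrite in_itv /= => tab.
  by apply: is_deriveB; [exact: dg|exact: df].
have [c] := MVT ab dgf cgf.
rewrite in_itv /= => cab E.
have : 0 <= (g - f) b - (g - f) a.
  by rewrite E mulr_ge0 ?subr_ge0 ?(ltW ab) ?fg.
rewrite !fctE; lra.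
Qed.

Lemma is_derive_continuous (R : realType) (f : R -> R) (t df : R) :
  is_derive t 1 f df -> {for t, continuous f}.
Proof. by move=> [d _]; apply: differentiable_continuous; apply/derivable1_diffP. Qed.

(** Integrating factor: once [r] is below [c * (e / 2)], the function [(u t - e / 2) * expR (c * t)]
    no longer increases, so [u] exceeds [e / 2] by at most a multiple of [expR (- c * t)]. *)
Lemma comparison_cvg0 (R : realType) (u u' r : R -> R) (c : R) :
  0 < c ->
  (forall t : R, 0 < t -> is_derive t 1 u (u' t)) ->
  (forall t : R, 0 < t -> u' t <= - c * u t + r t) ->
  (forall t : R, 0 < t -> 0 <= u t) ->
  r t @[t --> +oo] --> (0 : R) -> u t @[t --> +oo] --> (0 : R).
Proof.
move=> c0 du le_u' u0 r0; apply/cvgrPdist_lt => /= e e0.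
have /cvgrPdist_lt/(_ (c * (e / 2))) := r0.
rewrite !mulr_gt0 ?invr_gt0// => /(_ isT) [T0 [_ rT]].
(* At least 1, so that the derivative of [u] is available; strictly above [T0], since the bound on
   [r] holds only past [T0]. *)
pose T := Num.max 1 (T0 + 1).
have T1 : 1 <= T by rewrite /T le_max lexx.
have TT0 : T0 < T by rewrite /T lt_max; apply/orP; right; lra.
pose h t := (u t - e / 2) * expR (c * t).
have dh t : T <= t ->
    is_derive t 1 h ((u' t + c * (u t - e / 2)) * expR (c * t)).
  move=> Tt; have t0 : 0 < t by lra.
  have := du t t0 => dut.
  rewrite /h; apply: is_derive_eq.
  rewrite /GRing.scale /=; ring.
have ch t : T <= t -> {for t, continuous h}.
  by move=> /dh/is_derive_continuous.
have hT t : T <= t -> h t <= h T.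
  move=> Tt.
  have := @is_derive_increment_le R h (cst 0)
    (fun t => (u' t + c * (u t - e / 2)) * expR (c * t)) (cst 0) T t Tt.
  rewrite subrr subr_le0; apply.
  - apply: continuous_in_subspaceT => x; rewrite inE /= in_itv /= => /andP[Tx _].
    exact: ch.
  - by apply: continuous_subspaceT => x; exact: cvg_cst.
  - by move=> s /andP[/ltW Ts _]; exact: dh.
  - move=> s /andP[Ts _]; rewrite /cst pmulr_lle0 ?expR_gt0//.
    have Ts0 : T0 < s by lra.
    have s0 : 0 < s by lra.
    have := le_u' s s0; have := rT s Ts0.
    rewrite sub0r normrN ltr_norml => /andP[_]; lra.
near=> t.
have Tt : T <= t by near: t; apply: nbhs_pinfty_ge; rewrite num_real.
have t0 : 0 < t by lra.
rewrite sub0r normrN ger0_norm ?u0//.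
have ht := hT t Tt.
have ect : 1 + c * t <= expR (c * t) by exact: expR_ge1Dx.
(* The threshold at which [1 + c * t], a lower bound of the exponential, overtakes
   [h T / (e / 2)]. *)
have tK : (h T / (e / 2) - 1) / c < t.
  by near: t; apply: nbhs_pinfty_gt; rewrite num_real.
have hTt : h T < (e / 2) * expR (c * t).
  rewrite [ltRHS]mulrC -ltr_pdivrMr ?divr_gt0//; apply: lt_le_trans ect.
  by rewrite -ltrBlDl [ltRHS]mulrC -ltr_pdivrMr.
have : h t < (e / 2) * expR (c * t) by lra.
rewrite /h ltr_pM2r ?expR_gt0//; lra.
Unshelve. all: by end_near. Qed.

(** * Picard iteration *)

(* An antiderivative of [h] on [0, +oo[, extended by the constant 0 to the left
   so that it is continuous on the whole line.  The integral starts at -1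
   because the fundamental theorem of calculus only applies above its lower
   endpoint. *)
Definition primitive (R : realType) (h : R -> R) (t : R) : R :=
  \int[lebesgue_measure]_(s in `[-1, Num.max t 0]) h s -
  \int[lebesgue_measure]_(s in `[-1, 0]) h s.

Lemma is_derive_integral (R : realType) (h : R -> R) (t : R) :
  continuous h -> -1 < t ->
  is_derive t 1 (fun x => \int[lebesgue_measure]_(s in `[-1, x]) h s) (h t).
Proof.
move=> ch t1.
have ih : (@lebesgue_measure R).-integrable `[-1, t + 1] (EFin \o h).
  apply: continuous_compact_integrable; first exact: segment_compact.
  exact: continuous_subspaceT.
have [] := @continuous_FTC1_closed R h (-1) t (t + 1) _ ih t1 (ch t).
  by rewrite ltrDl.
by move=> d E; apply: DeriveDef => //; rewrite -derive1E.
Qed.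

Lemma primitive0 (R : realType) (h : R -> R) : primitive h 0 = 0.
Proof. by rewrite /primitive maxxx subrr. Qed.

Lemma primitive_max0 (R : realType) (h : R -> R) (t : R) :
  primitive h (Num.max t 0) = primitive h t.
Proof. by rewrite /primitive -maxA maxxx. Qed.

Lemma continuous_max0 (R : realType) : continuous (fun t : R => Num.max t 0).
Proof.
move=> x; apply: (@continuous_max _ _ (fun t : R => t) (fun=> 0)).
  exact: cvg_id.
exact: cvg_cst.
Qed.

Lemma continuous_primitive (R : realType) (h : R -> R) :
  continuous h -> continuous (primitive h).
Proof.
move=> ch t; rewrite /primitive; apply: cvgB; last exact: cvg_cst.
apply: (@continuous_comp _ _ _ (fun t : R => Num.max t 0)
  (fun x => \int[lebesgue_measure]_(s in `[-1, x]) h s)).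
  exact: continuous_max0.
apply: is_derive_continuous; apply: is_derive_integral => //.
by rewrite lt_max ltrN10 orbT.
Qed.

Lemma is_derive_primitive (R : realType) (h : R -> R) (t : R) :
  continuous h -> 0 < t -> is_derive t 1 (primitive h) (h t).
Proof.
move=> ch t0.
have D : is_derive t 1 (fun x : R =>
    \int[lebesgue_measure]_(s in `[-1, x]) h s -
    \int[lebesgue_measure]_(s in `[-1, 0]) h s) (h t).
  have -> : h t = h t - 0 by rewrite subr0.
  apply: is_deriveB.
  by apply: is_derive_integral => //; lra.
apply: near_eq_is_derive D; near=> x; rewrite /primitive max_l//.
by apply: ltW; near: x; exact: lt_nbhsr.
Unshelve. all: by end_near. Qed.

(** Stands for the integral triangle inequality: a majorant is given through its antiderivative
    [phi], so every later estimate only has to differentiate an exponential or a linear function. *)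
Lemma primitive_dist_le (R : realType) (h1 h2 phi phi' : R -> R) (t : R) :
  continuous h1 -> continuous h2 -> continuous phi ->
  (forall s : R, is_derive s 1 phi (phi' s)) -> 0 <= t ->
  (forall s : R, 0 < s < t -> `|h1 s - h2 s| <= phi' s) ->
  `|primitive h1 t - primitive h2 t| <= phi t - phi 0.
Proof.
move=> c1 c2 cphi dphi t0 le12.
have cp (h k : R -> R) : continuous h -> continuous k ->
    {within `[0, t], continuous (primitive h - primitive k)}.
  move=> ch ck; apply: continuous_subspaceT => s.
  by apply: cvgB; exact: continuous_primitive.
have dp (h k : R -> R) (s : R) : continuous h -> continuous k -> 0 < s < t ->
    is_derive s 1 (primitive h - primitive k) (h s - k s).
  by move=> ch ck /andP[s0 _]; apply: is_deriveB; exact: is_derive_primitive.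
have half (h k : R -> R) : continuous h -> continuous k ->
    (forall s : R, 0 < s < t -> h s - k s <= phi' s) ->
    primitive h t - primitive k t <= phi t - phi 0.
  move=> ch ck hk.
  have := @is_derive_increment_le R (primitive h - primitive k) phi
    (fun s => h s - k s) phi' 0 t t0 (cp _ _ ch ck)
    (continuous_subspaceT cphi) (fun s st => dp _ _ s ch ck st)
    (fun s _ => dphi s) hk.
  by rewrite !fctE /= !primitive0 !subr0.
rewrite ler_norml; apply/andP; split; last first.
  by apply: half => // s /le12; rewrite ler_norml => /andP[].
rewrite lerNl opprB; apply: half => // s /le12.
by rewrite ler_norml => /andP[H _]; rewrite -opprB lerNl.
Qed.

(** * Limits of sequences with geometrically decreasing increments *)

(** The intervals of centre [u k] and radius [2 * A / 2 ^+ k], the tail of the geometric series, are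
    nested; the limit is the supremum of their left ends. *)
Lemma geometric_limit (R : realType) (u : nat -> R) (A : R) :
  (forall k, `|u k.+1 - u k| <= A / 2 ^+ k) ->
  exists l, forall k, `|l - u k| <= 2 * A / 2 ^+ k.
Proof.
move=> uA.
pose lo k := u k - 2 * A / 2 ^+ k; pose hi k := u k + 2 * A / 2 ^+ k.
have A0 : 0 <= A by have := le_trans (normr_ge0 _) (uA 0%N); rewrite divr1.
have AE k : 2 * A / 2 ^+ k.+1 = 2 * A / 2 ^+ k - A / 2 ^+ k.
  rewrite exprS invfM; set x := (2 ^+ k)^-1.
  lra.
have Age0 k : 0 <= A / 2 ^+ k by rewrite divr_ge0// exprn_ge0.
have loS k m : lo k <= lo (k + m)%N.
  elim: m => [|m IH]; first by rewrite addn0.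
  apply: le_trans IH _; rewrite addnS /lo AE.
  have := uA (k + m)%N; rewrite ler_norml => /andP[]; lra.
have hiS k m : hi (k + m)%N <= hi k.
  elim: m => [|m IH]; first by rewrite addn0.
  apply: le_trans IH; rewrite addnS /hi AE.
  have := uA (k + m)%N; rewrite ler_norml => /andP[]; lra.
have lohi k m : lo k <= hi m.
  apply: (le_trans (loS k m)); apply: le_trans (hiS m k).
  rewrite addnC /lo /hi; have := Age0 (m + k)%N; lra.
exists (sup (range lo)) => k.
have ub : has_ubound (range lo).
  by exists (hi 0%N) => _ [j _ <-].
have H1 : lo k <= sup (range lo) by apply: ub_le_sup => //; exists k.
have H2 : sup (range lo) <= hi k.
  by apply: ge_sup => [|_ [j _ <-]//]; exists (lo 0%N), 0%N.
rewrite ler_norml; move: H1 H2; rewrite /lo /hi; lra.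
Qed.

Lemma geometric_small (R : realType) (A e : R) :
  0 < e -> exists k, A / 2 ^+ k < e.
Proof.
move=> e0; exists (Num.bound (e^-1 * A)).
by rewrite ltr_pdivrMr ?exprn_gt0// -ltr_pdivrMl// upper_nthrootP.
Qed.

Lemma geometric_eq0 (R : realType) (A x : R) :
  (forall k, `|x| <= A / 2 ^+ k) -> x = 0.
Proof.
move=> xA; apply/eqP/negPn/negP => x0.
have /(geometric_small A)[k] : 0 < `|x| by rewrite normr_gt0.
by rewrite ltNge xA.
Qed.

Section Picard.
Variables (R : realType) (I : finType) (F : R -> (I -> R) -> I -> R).
Variable x0 : I -> R.

Fixpoint picard_iter (k : nat) : R -> I -> R :=
  if k is k'.+1 then
    fun t i => x0 i + primitive (fun s => F s (picard_iter k' s) i) t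
  else fun _ => x0.

(** A box growing at rate [c], with its own size for each coordinate. It suits Picard iteration
    because the antiderivative of [c * C i * expR (c * t)] vanishing at 0 is
    [C i * expR (c * t) - C i], which leaves exactly the room [C i] for the initial value. *)
Definition in_region (C : I -> R) (c t : R) (Y : I -> R) : Prop :=
  forall j, `|Y j| <= C j * expR (c * t).

Hypothesis F_continuous : forall X : R -> I -> R,
  (forall i, continuous (X^~ i)) -> forall i, continuous (fun t => F t (X t) i).

(** For each horizon [T], a region preserved by the Picard operator and a Lipschitz constant valid
    inside it only. All constants may depend on [T]: this replaces a global Lipschitz condition. *)
Hypothesis F_region : forall T : R, 0 < T -> exists (C : I -> R) (c L : R),
  [/\ 0 < c, 0 < L, forall i, `|x0 i| <= C i,
      forall (t : R) Y, 0 <= t <= T -> in_region C c t Y ->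
        forall i, `|F t Y i| <= c * C i * expR (c * t) &
      forall (t : R) Y Z (e : R), 0 <= t <= T ->
        in_region C c t Y -> in_region C c t Z ->
        (forall j, `|Y j - Z j| <= e) -> forall i, `|F t Y i - F t Z i| <= L * e].

Lemma continuous_picard_iter k i : continuous ((picard_iter k)^~ i).
Proof.
elim: k i => [|k IH] i t; first exact: cvg_cst.
apply: cvgD; first exact: cvg_cst.
by apply: continuous_primitive; exact: F_continuous.
Qed.

(** The iterates are frozen at negative times, so estimates on [0, T] extend to all [t <= T]; a
    two-sided neighbourhood of 0 then needs no special treatment. *)
Lemma picard_iter_max0 k t : picard_iter k (Num.max t 0) = picard_iter k t.
Proof. by case: k => [//|k]; apply/funext => i /=; rewrite primitive_max0. Qed.

Lemma is_derive_scaled_exp (a c s : R) :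
  is_derive s 1 (fun x => a * expR (c * x)) (c * a * expR (c * s)).
Proof.
by apply: is_derive_eq; rewrite /GRing.scale /=; ring.
Qed.

Lemma continuous_scaled_exp (a c : R) : continuous (fun x => a * expR (c * x)).
Proof. by move=> s; apply: is_derive_continuous; exact: is_derive_scaled_exp. Qed.

Lemma picard_iter_in_region (C : I -> R) (c T : R) : 0 < c ->
  (forall i, `|x0 i| <= C i) ->
  (forall (t : R) Y, 0 <= t <= T -> in_region C c t Y ->
     forall i, `|F t Y i| <= c * C i * expR (c * t)) ->
  forall k t, 0 <= t <= T -> in_region C c t (picard_iter k t).
Proof.
move=> c0 xC FC; elim=> [|k IH] t /andP[t0 tT] i /=.
  apply: (le_trans (xC i)); rewrite ler_peMr//.
    by rewrite (le_trans _ (xC i)).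
  by rewrite -expR0 ler_expR mulr_ge0// ltW.
have cF : continuous (fun s => F s (picard_iter k s) i).
  by apply: F_continuous => j; exact: continuous_picard_iter.
have c0' : continuous (fun _ : R => 0 : R) by move=> ?; exact: cvg_cst.
(* Comparison with the zero integrand turns the distance estimate into a bound on a single
   primitive. *)
have H := @primitive_dist_le R _ (fun=> 0) (fun x => C i * expR (c * x)) _ t cF c0'
  (@continuous_scaled_exp (C i) c) (@is_derive_scaled_exp (C i) c) t0.
have {H} H : `|primitive (fun s => F s (picard_iter k s) i) t - primitive (fun=> 0) t|
    <= C i * expR (c * t) - C i * expR (c * 0).
  apply: H => s /andP[s0 st]; rewrite subr0; apply: FC.
    by rewrite (ltW s0) (le_trans (ltW st)).
  by apply: IH; rewrite (ltW s0) (le_trans (ltW st)).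
have p0 : primitive (fun=> 0 : R) t = 0.
  by rewrite /primitive !Rintegral_cst//= !mul0r subr0.
rewrite p0 subr0 mulr0 expR0 mulr1 in H.
apply: le_trans (ler_normD _ _) _; have := xC i; lra.
Qed.

(** Distances are weighed against [expR (2 * L * t)]: integrating [L] times this weight gives at
    most half of it, so each iteration halves the distance on all of [0, T] and no short intervals
    have to be glued. *)
Lemma picard_iter_dist (C : I -> R) (c L T : R) : 0 < L ->
  (forall k t, 0 <= t <= T -> in_region C c t (picard_iter k t)) ->
  (forall (t : R) Y Z (e : R), 0 <= t <= T ->
     in_region C c t Y -> in_region C c t Z ->
     (forall j, `|Y j - Z j| <= e) -> forall i, `|F t Y i - F t Z i| <= L * e) ->
  forall D, (forall t i, 0 <= t <= T -> `|picard_iter 1 t i - x0 i| <= D) ->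
  forall k t i, 0 <= t <= T ->
    `|picard_iter k.+1 t i - picard_iter k t i|
      <= D * expR (2 * L * t) / 2 ^+ k.
Proof.
move=> L0 reg FL D D1; elim=> [|k IH] t i /andP[t0 tT].
  rewrite expr0 divr1; apply: le_trans (D1 t i _) _; first by rewrite t0.
  rewrite ler_peMr//.
    by apply: le_trans (normr_ge0 _) (D1 0 i _); rewrite lexx (le_trans t0).
  by rewrite -expR0 ler_expR !mulr_ge0// ltW.
pose a := D / 2 ^+ k.+1.
have cF m : continuous (fun s => F s (picard_iter m s) i).
  by apply: F_continuous => j; exact: continuous_picard_iter.
have H := @primitive_dist_le R _ _ (fun x => a * expR (2 * L * x)) _ t
  (cF k.+1) (cF k) (@continuous_scaled_exp a (2 * L))
  (@is_derive_scaled_exp a (2 * L)) t0.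
have {H} H : `|picard_iter k.+2 t i - picard_iter k.+1 t i|
    <= a * expR (2 * L * t) - a * expR (2 * L * 0).
  rewrite /= opprD addrACA subrr add0r.
  apply: H => s /andP[s0 st].
  have sT : 0 <= s <= T by rewrite (ltW s0) (le_trans (ltW st)).
  have := FL s _ _ _ sT (reg k.+1 s sT) (reg k s sT) (fun j => IH s j sT) i.
  move=> /le_trans; apply; rewrite /a exprS invfM.
  rewrite le_eqVlt; apply/orP; left; apply/eqP; field.
  by rewrite expf_neq0.
apply: (le_trans H); rewrite mulr0 expR0 mulr1 /a.
rewrite [leRHS]mulrAC gerBl divr_ge0 ?exprn_ge0//.
by apply: le_trans (normr_ge0 _) (D1 0 i _); rewrite lexx (le_trans t0).
Qed.

Lemma picard_iter_uniform_cauchy (T : R) : 0 < T ->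
  exists D, forall k t i, t <= T ->
    `|picard_iter k.+1 t i - picard_iter k t i| <= D / 2 ^+ k.
Proof.
move=> T0; have [C [c [L [c0 L0 xC FC FL]]]] := F_region T0.
have C0 i : 0 <= C i by apply: le_trans (xC i).
have reg := picard_iter_in_region c0 xC FC.
(* A crude bound for the first increment: both terms of the difference lie in the region up to time
   [T]. *)
pose D1 := \sum_i C i * expR (c * T) + \sum_i C i.
have D1P t i : 0 <= t <= T -> `|picard_iter 1 t i - x0 i| <= D1.
  move=> tT; apply: le_trans (ler_normB _ _) _; apply: lerD.
    apply: le_trans (reg 1%N t tT i) _.
    rewrite (bigD1 i)//= -[leLHS]addr0 lerD ?sumr_ge0//; last first.
      by move=> j _; rewrite mulr_ge0 ?expR_ge0.
    by rewrite ler_wpM2l// ler_expR ler_pM2l//; case/andP: tT.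
  by rewrite (bigD1 i)//= -[leLHS]addr0 lerD ?sumr_ge0.
exists (D1 * expR (2 * L * T)) => k t i tT.
have mT : 0 <= Num.max t 0 <= T by rewrite le_max lexx orbT ge_max tT ltW.
rewrite -(picard_iter_max0 k.+1) -(picard_iter_max0 k).
apply: le_trans (picard_iter_dist L0 reg FL D1P k i mT) _.
rewrite ler_pM2r ?invr_gt0 ?exprn_gt0// ler_wpM2l//.
  by rewrite /D1 addr_ge0// sumr_ge0// => j _; rewrite mulr_ge0 ?expR_ge0.
by rewrite ler_expR ler_pM2l ?mulr_gt0//; case/andP: mT.
Qed.

Lemma picard_limit : exists X : R -> I -> R, forall T, 0 < T ->
  exists2 D, 0 <= D & forall k t i, t <= T ->
    `|X t i - picard_iter k t i| <= D / 2 ^+ k.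
Proof.
(* The limit at [t] is defined with a horizon depending on [t]; uniqueness of geometric limits then
   transfers the bound to a constant common to all times up to [T]. *)
pose ub (t : R) := Num.max t 0 + 1.
have ub0 (t : R) : 0 < ub t by rewrite ltr_pwDr// le_max lexx orbT.
have tub (t : R) : t <= ub t.
  by rewrite (@le_trans _ _ (Num.max t 0))// ?le_max ?lexx// lerDl.
have lim t i : {l | exists A, forall k, `|l - picard_iter k t i| <= A / 2 ^+ k}.
  apply: cid; have [D DP] := picard_iter_uniform_cauchy (ub0 t).
  have [l lP] := @geometric_limit R (fun k => picard_iter k t i) D
    (fun k => DP k t i (tub t)).
  by exists l, (2 * D).
exists (fun t i => sval (lim t i)) => T T0.
have [D DP] := picard_iter_uniform_cauchy T0.
exists `|2 * D| => // k t i tT.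
have [l lP] := @geometric_limit R (fun k => picard_iter k t i) D
    (fun k => DP k t i tT).
case: (lim t i) => l' [A AP] /=.
suff -> : l' = l.
  by apply: le_trans (lP k) _; rewrite ler_pM2r ?invr_gt0 ?exprn_gt0// ler_norm.
apply/eqP; rewrite -subr_eq0; apply/eqP.
apply: (@geometric_eq0 _ (A + 2 * D)) => m.
rewrite mulrDl (le_trans _ (lerD (AP m) (lP m)))//.
rewrite [X in _ <= _ + X]distrC.
by apply: le_trans (ler_normD _ _); rewrite addrA subrK.
Qed.

(** Continuity of the limit comes from uniform convergence on left half-lines. The limit is then
    shown to satisfy the integral equation, which is differentiated. *)
Theorem picard_lindelof : exists X : R -> I -> R,
  [/\ X 0 = x0, forall i, continuous (X^~ i) &
      forall (t : R) i, 0 < t -> is_derive t 1 (X^~ i) (F t (X t) i)].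
Proof.
have [X XP] := picard_limit.
have cX i : continuous (X^~ i).
  move=> t; apply/cvgrPdist_lt => /= e e0.
  have T0 : 0 < Num.max t 0 + 1 by rewrite ltr_pwDr// le_max lexx orbT.
  have [D D0 DP] := XP _ T0.
  have [k kD] := @geometric_small R D (e / 3) (divr_gt0 e0 (ltr0Sn _ 2)).
  have := @continuous_picard_iter k i t.
  move=> /cvgrPdist_lt/(_ (e / 3) (divr_gt0 e0 (ltr0Sn _ 2))) H.
  have tT : t < Num.max t 0 + 1.
    by rewrite (@le_lt_trans _ _ (Num.max t 0))// ?le_max ?lexx// ltrDl.
  near=> s.
  have H1 := DP k t i (ltW tT).
  have H2 : `|X s i - picard_iter k s i| <= D / 2 ^+ k.
    apply: DP; apply: ltW; near: s; exact: lt_nbhsl.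
  have H3 : `|picard_iter k t i - picard_iter k s i| < e / 3.
    by near: s; exact: H.
  rewrite distrC in H2.
  rewrite (_ : X t i - X s i = (X t i - picard_iter k t i) +
    (picard_iter k t i - picard_iter k s i) + (picard_iter k s i - X s i)); last by ring.
  apply: le_lt_trans (ler_normD _ _) _.
  have := ler_normD (X t i - picard_iter k t i) (picard_iter k t i - picard_iter k s i).
  lra.
have cFX i : continuous (fun s => F s (X s) i) by exact: F_continuous.
have cF k i : continuous (fun s => F s (picard_iter k s) i).
  by apply: F_continuous => j; exact: continuous_picard_iter.
have XE (t : R) i : X t i = x0 i + primitive (fun s => F s (X s) i) t.
  (* At negative times both sides keep their value at 0. *)
  wlog t0 : t / 0 <= t.
    move=> wl; have T0 : 0 < Num.max t 0 + 1 by rewrite ltr_pwDr// le_max lexx orbT.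
    have [D _ DP] := XP _ T0.
    rewrite -primitive_max0 -wl ?le_max ?lexx ?orbT//.
    apply/eqP; rewrite -subr_eq0; apply/eqP/(@geometric_eq0 _ (D + D)) => k.
    have H1 := DP k (Num.max t 0) i; have H2 := DP k t i.
    rewrite picard_iter_max0 distrC in H1.
    rewrite mulrDl (le_trans _ (lerD (H2 _) (H1 _)))//.
    - by apply: le_trans (ler_normD _ _); rewrite addrA subrK.
    - by rewrite (@le_trans _ _ (Num.max t 0))// ?le_max ?lexx// lerDl.
    - by rewrite lerDl.
  pose T := t + 1; have T0 : 0 < T by rewrite ltr_pwDr.
  have tT : t <= T by rewrite lerDl.
  have [D D0 DP] := XP _ T0.
  have [C [c [L [c0 L0 xC FC FL]]]] := F_region T0.
  have reg := picard_iter_in_region c0 xC FC.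
  (* The region is closed, so the limit stays in it and the local Lipschitz bound applies to the
     limit as well. *)
  have regX s : 0 <= s <= T -> in_region C c s (X s).
    move=> sT j; apply/ler_addgt0Pr => e e0.
    have [k kD] := @geometric_small R D e e0.
    have := DP k s j; case/andP: (sT) => _ -> /(_ isT) H.
    have := reg k s sT j; have := ler_normD (X s j - picard_iter k s j) (picard_iter k s j).
    rewrite subrK; lra.
  (* The defect of the integral equation is split at iterate [k.+1]: the distance to the limit costs
     [D], replacing iterate [k] by the limit inside the primitive costs [L * D * t], both over
     [2 ^+ k]. *)
  apply/eqP; rewrite -subr_eq0; apply/eqP/(@geometric_eq0 _ (D + L * D * t)) => k.
  have H1 := DP k.+1 t i tT.
  pose a := L * (D / 2 ^+ k).
  have da (s : R) : is_derive s 1 (fun x : R => a * x) a.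
    by apply: is_derive_eq; rewrite /GRing.scale /= mulr1.
  have ca : continuous (fun x : R => a * x).
    by move=> s; apply: is_derive_continuous; exact: da.
  have H2 := @primitive_dist_le R _ _ (fun x => a * x) _ t
    (cF k i) (cFX i) ca da t0.
  have {H2} H2 : `|primitive (fun s => F s (picard_iter k s) i) t -
      primitive (fun s => F s (X s) i) t| <= a * t - a * 0.
    apply: H2 => s /andP[s0 st].
    have sT : 0 <= s <= T by rewrite (ltW s0) (le_trans (ltW st)).
    apply: FL => //; [exact: reg|exact: regX|].
    by move=> j; rewrite distrC; apply: DP; case/andP: sT.
  have E : X t i - (x0 i + primitive (fun s => F s (X s) i) t) =
    (X t i - picard_iter k.+1 t i) + (primitive (fun s => F s (picard_iter k s) i) t -
      primitive (fun s => F s (X s) i) t) by rewrite /=; ring.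
  rewrite E (le_trans (ler_normD _ _))// mulrDl lerD//.
    apply: (le_trans H1); rewrite ler_wpM2l// exprS invfM ler_piMl// ?invr_ge0 ?exprn_ge0//.
    lra.
  apply: (le_trans H2); rewrite /a le_eqVlt; apply/orP; left; apply/eqP; field.
  by rewrite expf_neq0.
exists X; split=> // [|t i t0].
  by apply/funext => i; rewrite XE primitive0 addr0.
have -> : X^~ i = (fun t => x0 i + primitive (fun s => F s (X s) i) t).
  by apply/funext => s; exact: XE.
rewrite -[F _ _ _]add0r; apply: is_deriveD.
exact: is_derive_primitive.
Unshelve. all: by end_near. Qed.

End Picard.

(** * Local Lipschitz bounds for smooth maps *)

Lemma is_derive_segment (R : realType) (U : normedModType R) (phi : U -> R)
    (x y : U) (s : R) :
  (forall u, differentiable phi u) ->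
  is_derive s 1 (fun r : R => phi (y + r *: (x - y)))
    ('D_(x - y) phi (y + s *: (x - y))).
Proof.
move=> dphi.
have dl : is_diff s (fun r : R => y + r *: (x - y)) (fun r : R => r *: (x - y)).
  by apply: is_diff_eq; apply/funext => r; rewrite !fctE; rewrite add0r.
have dphi' : is_diff (y + s *: (x - y)) phi ('d phi (y + s *: (x - y))).
  exact/differentiableP.
have D := is_diff_comp dl dphi'.
have dd : differentiable (phi \o (fun r : R => y + r *: (x - y))) s.
  exact: ex_diff.
apply: DeriveDef; first exact/derivable1_diffP.
by rewrite !deriveE// diff_val /= scale1r.
Qed.

(** The mean value theorem along a segment, with the derivative expanded on a spanning family whose
    partial derivatives are bounded on [K]. The family [e] and the coordinates [c] are abstract so
    that the result covers both column vectors and pairs of them. *)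
Lemma lipschitz_compact_convex (R : realType) (U : normedModType R)
    (J : finType) (e : J -> U) (c : U -> J -> R) (K : set U) (phi : U -> R) :
  (forall u, u = \sum_j c u j *: e j) ->
  compact K ->
  (forall x y s, K x -> K y -> 0 <= s <= 1 -> K (y + s *: (x - y))) ->
  (forall u, differentiable phi u) ->
  (forall j, continuous (fun u => 'D_(e j) phi u)) ->
  exists2 L, 0 <= L & forall x y, K x -> K y ->
    `|phi x - phi y| <= L * \sum_j `|c (x - y) j|.
Proof.
move=> ec cK convK dphi cDphi.
have bnd j : {M | forall u, K u -> `|'D_(e j) phi u| <= M}.
  apply: cid.
  have /compact_bounded[M [_ MP]] : compact ((fun u => 'D_(e j) phi u) @` K).
    by apply: continuous_compact => //; apply: continuous_subspaceT; exact: cDphi.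
  exists (M + 1) => u Ku; apply: (MP (M + 1)); first by rewrite ltrDl.
  by exists u.
pose L := \sum_j `|sval (bnd j)|.
exists L; first exact: sumr_ge0.
move=> x y Kx Ky.
pose h (r : R) := phi (y + r *: (x - y)).
have dh (s : R) : s \in `]0, 1[ -> is_derive s 1 h ('D_(x - y) phi (y + s *: (x - y))).
  by move=> _; exact: is_derive_segment.
have ch : {within `[0, 1], continuous h}.
  apply: continuous_subspaceT => s; apply: is_derive_continuous.
  exact: is_derive_segment.
have [s + E] := MVT ltr01 dh ch; rewrite in_itv /= => /andP[s0 s1].
have -> : phi x - phi y = 'D_(x - y) phi (y + s *: (x - y)).
  move: E; rewrite /h scale1r scale0r addr0 subr0 mulr1.
  by rewrite [y + (x - y)]addrC subrK.
set u := y + _.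
have Ku : K u by apply: convK; rewrite // !ltW.
rewrite deriveE// {1}[x - y]ec linear_sum mulr_sumr.
apply: le_trans (ler_norm_sum _ _ _) _; apply: ler_sum => j _.
rewrite linearZ /= normrM mulrC ler_wpM2r// -deriveE//.
apply: (le_trans (svalP (bnd j) u Ku)); apply: (le_trans (ler_norm _)).
by rewrite /L (bigD1 j)//= lerDl sumr_ge0.
Qed.

Definition box (R : realType) n (r : R) : set 'cV[R]_n :=
  [set x | forall k, `|x k 0| <= r].

Lemma coord_derive (R : realType) (U : normedModType R) m
    (f : U -> 'cV[R]_m) (u v : U) k :
  differentiable f u -> 'D_v (fun x => f x k 0) u = 'D_v f u k 0.
Proof. by move=> df; rewrite derive_mx ?mxE//; exact: diff_derivable. Qed.

Lemma smooth_coord (R : realType) (U : normedModType R) m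
    (f : U -> 'cV[R]_m) k : smooth f ->
  (forall u, differentiable (fun x => f x k 0) u) /\
  (forall v, continuous (fun u => 'D_v (fun x => f x k 0) u)).
Proof.
move=> /(_ 1%N)[df cf]; split=> [u|v].
  apply: (@differentiable_comp _ _ _ _ f (fun M : 'cV[R]_m => M k 0)) => //.
  exact: differentiable_coord.
under eq_fun do rewrite coord_derive//.
move=> u; apply: (@continuous_comp _ _ _ (fun u => 'D_v f u) (fun M : 'cV[R]_m => M k 0)).
  exact: cf.
exact: coord_continuous.
Qed.

Lemma continuous_trmx (R : realType) m n :
  continuous (fun M : 'M[R]_(m, n) => M^T).
Proof.
move=> M B [V nV VB]; exists (fun i j => V j i) => [i j|N NV].
  by have := nV j i; rewrite mxE.
by apply: VB => i j; rewrite mxE; exact: NV.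
Qed.

Lemma compact_box (R : realType) n (r : R) : compact (@box R n r).
Proof.
have c : compact [set v : 'rV[R]_n | forall i, v ord0 i \in `[- r, r]].
  by apply: (@rV_compact _ _ (fun=> `[- r, r]%classic)) => _; exact: segment_compact.
have -> : @box R n r = (fun v : 'rV[R]_n => v^T) @`
    [set v : 'rV[R]_n | forall i, v ord0 i \in `[- r, r]].
  apply/seteqP; split=> [x bx|_ [v vr <-] k].
    exists x^T; last exact: trmxK.
    by move=> i; rewrite mxE in_itv /= -ler_norml; exact: bx.
  by have := vr k; rewrite mxE in_itv /= -ler_norml.
apply: continuous_compact => //; apply: continuous_subspaceT.
exact: continuous_trmx.
Qed.

Lemma box_segment (R : realType) n (r : R) (x y : 'cV[R]_n) (s : R) :
  box r x -> box r y -> 0 <= s <= 1 -> box r (y + s *: (x - y)).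
Proof.
move=> bx By /andP[s0 s1] k; rewrite !mxE.
have -> : y k 0 + s * (x k 0 - y k 0) = s * x k 0 + (1 - s) * y k 0 by ring.
apply: le_trans (ler_normD _ _) _; rewrite !normrM (ger0_norm s0).
rewrite (@ger0_norm _ (1 - s)) ?subr_ge0//.
have -> : r = s * r + (1 - s) * r by ring.
by rewrite lerD// ler_wpM2l ?subr_ge0.
Qed.

Lemma col_delta_sum (R : realType) n (u : 'cV[R]_n) :
  u = \sum_j u j 0 *: delta_mx j 0.
Proof. by rewrite {1}(matrix_sum_delta u); under eq_bigr do rewrite big_ord1. Qed.

Lemma sum_le_const (R : realType) n (u : 'I_n -> R) (e : R) :
  (forall j, u j <= e) -> \sum_j u j <= n%:R * e.
Proof.
by move=> ue; rewrite -[n in n%:R]card_ord mulr_natl -sumr_const ler_sum.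
Qed.

Lemma smooth_lipschitz_box (R : realType) n m (f : 'cV[R]_n -> 'cV[R]_m) (r : R) :
  smooth f -> exists2 L, 0 <= L & forall x y (e : R), box r x -> box r y ->
    (forall j, `|x j 0 - y j 0| <= e) -> forall k, `|f x k 0 - f y k 0| <= L * e.
Proof.
move=> sf.
have lip k : {L | 0 <= L /\ forall x y, box r x -> box r y ->
    `|f x k 0 - f y k 0| <= L * \sum_j `|(x - y) j 0|}.
  apply: cid; have [df cf] := smooth_coord k sf.
  have [L L0 LP] := @lipschitz_compact_convex R _ _ (fun j : 'I_n => delta_mx j 0)
    (fun u j => u j 0) _ _ (@col_delta_sum R n) (@compact_box R n r)
    (@box_segment R n r) df (fun j => cf _).
  by exists L.
(* The sum over [k] is a constant common to all output coordinates; the factor [n%:R] passes from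
   the sum of the coordinate distances to their maximum. *)
exists (\sum_k sval (lip k) * n%:R).
  by apply: sumr_ge0 => k _; rewrite mulr_ge0//; case: (lip k) => L [].
move=> x y e bx By xye k.
have [L0 LP] := svalP (lip k); apply: (le_trans (LP _ _ bx By)).
have S : \sum_j `|(x - y) j 0| <= n%:R * e.
  by apply: sum_le_const => j; rewrite !mxE.
apply: (le_trans (ler_wpM2l L0 S)); rewrite mulrA.
have n_e : 0 <= n%:R * e by apply: le_trans S; exact: sumr_ge0.
rewrite mulr_suml (bigD1 k)//= lerDl sumr_ge0// => j _.
by rewrite -mulrA mulr_ge0//; case: (lip j) => ? [].
Qed.

Lemma smooth2_lipschitz_box (R : realType) n m
    (g : 'cV[R]_n -> 'cV[R]_m -> R) (r : R) :
  smooth (fun p : 'cV[R]_n * 'cV[R]_m => g p.1 p.2) ->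
  exists2 L, 0 <= L & forall z z' x x' (e : R),
    box r z -> box r z' -> box r x -> box r x' ->
    (forall j, `|z j 0 - z' j 0| <= e) -> (forall j, `|x j 0 - x' j 0| <= e) ->
    `|g z x - g z' x'| <= L * e.
Proof.
move=> /(_ 1%N)[dg cg].
pose b (j : 'I_n + 'I_m) : 'cV[R]_n * 'cV[R]_m :=
  match j with inl i => (delta_mx i 0, 0) | inr i => (0, delta_mx i 0) end.
pose c (u : 'cV[R]_n * 'cV[R]_m) (j : 'I_n + 'I_m) : R :=
  match j with inl i => u.1 i 0 | inr i => u.2 i 0 end.
have bc u : u = \sum_j c u j *: b j.
  rewrite big_sumType /=.
  have E1 (I : Type) (s : seq I) (F : I -> 'cV[R]_n * 'cV[R]_m) :
      (\sum_(i <- s) F i).1 = \sum_(i <- s) (F i).1.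
    by elim/big_rec2: _ => // i ? ? _ <-.
  have E2 (I : Type) (s : seq I) (F : I -> 'cV[R]_n * 'cV[R]_m) :
      (\sum_(i <- s) F i).2 = \sum_(i <- s) (F i).2.
    by elim/big_rec2: _ => // i ? ? _ <-.
  rewrite [LHS]surjective_pairing [RHS]surjective_pairing; congr pair.
    rewrite /= E1 E1 /= [X in _ + X]big1 ?addr0; last by move=> i _; exact: scaler0.
    exact: col_delta_sum.
  rewrite /= E2 E2 /= [X in X + _]big1 ?add0r; last by move=> i _; exact: scaler0.
  exact: col_delta_sum.
have [L L0 LP] := @lipschitz_compact_convex R _ _ b c (box r `*` box r)
  (fun p => g p.1 p.2) bc (compact_setX (@compact_box R n r) (@compact_box R m r))
  (fun x y s Kx Ky s01 => conj (box_segment Kx.1 Ky.1 s01) (box_segment Kx.2 Ky.2 s01))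
  dg (fun j => cg _).
exists (L * (n%:R + m%:R)) => [|z z' x x' e bz bz' bx bx' ze xe].
  by rewrite mulr_ge0.
apply: (le_trans (LP (z, x) (z', x') (conj bz bx) (conj bz' bx'))).
rewrite -mulrA ler_wpM2l// big_sumType /= mulrDl lerD//.
  by apply: sum_le_const => j; rewrite !mxE.
by apply: sum_le_const => j; rewrite !mxE.
Qed.

(** * Linear systems with a Hurwitz matrix *)

Section HurwitzDecay.
Variables (R : realType) (n : nat) (A : 'M[R]_n) (x : R -> 'cV[R]_n).
Hypothesis dx : forall t : R, 0 < t -> is_derive t 1 x (A *m x t).

Let C := R[i].
Let Ac : 'M[C]_n := map_mx (real_complex R) A.

(** The functional [b] is complex but the trajectory is real; keeping the value as two real
    functions leaves all derivatives and limits real. *)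
Definition Re_coord (b : 'rV[R[i]]_n) (t : R) : R :=
  \sum_l complex.Re (b 0 l) * x t l 0.
Definition Im_coord (b : 'rV[R[i]]_n) (t : R) : R :=
  \sum_l complex.Im (b 0 l) * x t l 0.

Definition decays (b : 'rV[R[i]]_n) : Prop :=
  Re_coord b t @[t --> +oo] --> (0 : R) /\
  Im_coord b t @[t --> +oo] --> (0 : R).

Lemma is_derive_coord (t : R) l : 0 < t ->
  is_derive t 1 (fun s => x s l 0) ((A *m x t) l 0).
Proof.
move=> t0; have [d E] := dx t0; apply: DeriveDef.
  by move/derivable_mxP : d; apply.
by rewrite -E derive_mx// mxE.
Qed.

Lemma is_derive_lin (c : 'I_n -> R) (t : R) : 0 < t ->
  is_derive t 1 (fun s => \sum_l c l * x s l 0)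
    (\sum_l (\sum_m c m * A m l) * x t l 0).
Proof.
move=> t0.
have -> : \sum_l (\sum_m c m * A m l) * x t l 0 =
    \sum_l c l * (A *m x t) l 0.
  under eq_bigr do rewrite mulr_suml.
  rewrite exchange_big /=; apply: eq_bigr => l _.
  by rewrite mxE mulr_sumr; apply: eq_bigr => m _; rewrite mulrA.
have -> : (fun s => \sum_l c l * x s l 0) = \sum_l (fun s => c l * x s l 0).
  by apply/funext => s; rewrite fct_sumE.
apply: is_derive_sum => l.
have := is_derive_coord l t0 => d.
apply: is_derive_eq; rewrite /GRing.scale/=; ring.
Qed.

Lemma Re_sum (I : Type) (s : seq I) (F : I -> R[i]) :
  complex.Re (\sum_(i <- s) F i) = \sum_(i <- s) complex.Re (F i).
Proof. by elim/big_rec2: _ => // i a b _ <-; case: (F i); case: b. Qed.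

Lemma Im_sum (I : Type) (s : seq I) (F : I -> R[i]) :
  complex.Im (\sum_(i <- s) F i) = \sum_(i <- s) complex.Im (F i).
Proof. by elim/big_rec2: _ => // i a b _ <-; case: (F i); case: b. Qed.

Lemma is_derive_Re_coord (b : 'rV[C]_n) (t : R) : 0 < t ->
  is_derive t 1 (Re_coord b) (Re_coord (b *m Ac) t).
Proof.
move=> t0; apply: is_derive_eq (is_derive_lin (fun l => complex.Re (b 0 l)) t0) _.
apply: eq_bigr => l _; congr (_ * _); rewrite mxE Re_sum; apply: eq_bigr => m _.
by rewrite mxE; case: (b 0 m) => p q /=; rewrite mulr0 subr0.
Qed.

Lemma is_derive_Im_coord (b : 'rV[C]_n) (t : R) : 0 < t ->
  is_derive t 1 (Im_coord b) (Im_coord (b *m Ac) t).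
Proof.
move=> t0; apply: is_derive_eq (is_derive_lin (fun l => complex.Im (b 0 l)) t0) _.
apply: eq_bigr => l _; congr (_ * _); rewrite mxE Im_sum; apply: eq_bigr => m _.
by rewrite mxE; case: (b 0 m) => p q /=; rewrite mulr0 add0r.
Qed.

Lemma coordD (b c : 'rV[C]_n) t :
  Re_coord (b + c) t = Re_coord b t + Re_coord c t /\
  Im_coord (b + c) t = Im_coord b t + Im_coord c t.
Proof.
split; rewrite -big_split; apply: eq_bigr => l _ /=; rewrite mxE -mulrDl;
  by case: (b 0 l); case: (c 0 l).
Qed.

Lemma coordZ (z : C) (b : 'rV[C]_n) t :
  Re_coord (z *: b) t = complex.Re z * Re_coord b t - complex.Im z * Im_coord b t /\
  Im_coord (z *: b) t = complex.Re z * Im_coord b t + complex.Im z * Re_coord b t.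
Proof.
split; rewrite !mulr_sumr -?sumrB -?big_split; apply: eq_bigr => l _ /=; rewrite mxE;
  case: z => a c; case: (b 0 l) => p q /=; ring.
Qed.

Lemma sqr_cvg0 (u v : R -> R) :
  (forall t : R, 0 < t -> v t ^+ 2 <= u t) ->
  u t @[t --> +oo] --> (0 : R) -> v t @[t --> +oo] --> (0 : R).
Proof.
move=> vu u0; apply/cvgrPdist_lt => /= e e0.
have /cvgrPdist_lt/(_ (e ^+ 2) (exprn_gt0 _ e0)) ue := u0.
near=> t; rewrite sub0r normrN.
rewrite -(ltr_pXn2r (ltn0Sn 1)) ?nnegrE ?(ltW e0)// real_normK ?num_real//.
have t0 : 0 < t by near: t; apply: nbhs_pinfty_gt; rewrite num_real.
apply: le_lt_trans (vu t t0) _.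
have : `|0 - u t| < e ^+ 2 by near: t.
by rewrite sub0r normrN; apply: le_lt_trans; exact: ler_norm.
Unshelve. all: by end_near. Qed.

(** The scalar function y = b x satisfies y' = z y + r with r decaying. For u = |y|^2 the rotation
    terms in Im z cancel, and Young's inequality gives u' <= Re z u + |r|^2 / (- Re z). *)
Lemma decays_factor (z : C) (b : 'rV[C]_n) :
  complex.Re z < 0 -> decays (b *m (Ac - z%:M)) -> decays b.
Proof.
move=> z0 [rp rq].
set r1 := Re_coord _ in rp; set r2 := Im_coord _ in rq.
pose a := complex.Re z; pose c := complex.Im z.
pose p := Re_coord b; pose q := Im_coord b.
have bE : b *m Ac = z *: b + b *m (Ac - z%:M).
  by rewrite mulmxBr mul_mx_scalar addrC subrK.
have dp (t : R) : 0 < t -> is_derive t 1 p (a * p t - c * q t + r1 t).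
  move=> t0; have := is_derive_Re_coord b t0.
  by rewrite bE (coordD _ _ t).1 (coordZ _ _ t).1.
have dq (t : R) : 0 < t -> is_derive t 1 q (a * q t + c * p t + r2 t).
  move=> t0; have := is_derive_Im_coord b t0.
  by rewrite bE (coordD _ _ t).2 (coordZ _ _ t).2.
pose u t := p t ^+ 2 + q t ^+ 2.
have u0 : u t @[t --> +oo] --> (0 : R).
  apply: (@comparison_cvg0 R u
    (fun t => 2 * p t * (a * p t - c * q t + r1 t) + 2 * q t * (a * q t + c * p t + r2 t))
    (fun t => (r1 t ^+ 2 + r2 t ^+ 2) / (- a)) (- a)).
  - by rewrite oppr_gt0.
  - move=> t t0; have := dp t t0 => d1; have := dq t t0 => d2.
    by rewrite /u; apply: is_derive_eq; rewrite /GRing.scale /=; ring.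
  - move=> t _; rewrite opprK -subr_ge0.
    have a0 : 0 < - a by rewrite oppr_gt0.
    (* Completing the squares: the slack of the inequality is a sum of two squares divided by
       [- a]. *)
    have -> : a * u t + (r1 t ^+ 2 + r2 t ^+ 2) / - a -
        (2 * p t * (a * p t - c * q t + r1 t) + 2 * q t * (a * q t + c * p t + r2 t)) =
        ((- a * p t - r1 t) ^+ 2 + (- a * q t - r2 t) ^+ 2) / (- a).
      by rewrite /u; field; rewrite ?oppr_eq0 lt_eqF.
    by rewrite divr_ge0 ?(ltW a0)// addr_ge0 ?sqr_ge0.
  - by move=> t _; rewrite addr_ge0 ?sqr_ge0.
  - rewrite -(mul0r (- a)^-1); apply: cvgMl.
    rewrite -[X in _ --> X](addr0 (0 : R)); apply: cvgD.
      by rewrite -[X in _ --> X](mulr0 (0 : R)); under eq_fun do rewrite expr2; exact: cvgM.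
    by rewrite -[X in _ --> X](mulr0 (0 : R)); under eq_fun do rewrite expr2; exact: cvgM.
split; apply: sqr_cvg0 u0 => t _; rewrite /u -/p -/q ?lerDl ?lerDr sqr_ge0//.
Qed.

End HurwitzDecay.

Lemma hurwitz_decay (R : realType) n (A : 'M[R]_n) (x : R -> 'cV[R]_n) :
  hurwitz A -> (forall t : R, 0 < t -> is_derive t 1 x (A *m x t)) ->
  forall k, x t k 0 @[t --> +oo] --> (0 : R).
Proof.
case: n A x => [|n] A x hA dx k; first by case: k.
pose Ac := map_mx (real_complex R) A.
(* Induction on the list of roots, with [b] generalized so that the first factor can be absorbed
   into it. Multiple roots are repeated entries, so no Jordan form occurs. On the full list the
   product vanishes by Cayley-Hamilton. *)
have factors (s : seq R[i]) : (forall z, z \in s -> complex.Re z < 0) ->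
    forall b : 'rV_n.+1, decays x (b *m horner_mx Ac (\prod_(z <- s) ('X - z%:P))) ->
    decays x b.
  elim: s => [_ b|z s IH sneg b].
    by rewrite big_nil rmorph1 mulmx1.
  rewrite big_cons rmorphM /= rmorphB /= horner_mx_X horner_mx_C -[_ * _]/(_ *m _) mulmxA.
  move=> /IH H; apply: (decays_factor dx (z := z)).
    by apply: sneg; rewrite mem_head.
  by apply: H => w ws; apply: sneg; rewrite in_cons ws orbT.
have [s sE] := closed_field_poly_normal (char_poly Ac).
rewrite (monicP (char_poly_monic Ac)) scale1r in sE.
have [] : decays x (delta_mx 0 k).
  apply: (factors s); last first.
    rewrite -sE Cayley_Hamilton mulmx0.
    have H0 : (Re_coord x 0 = fun=> 0) /\ (Im_coord x 0 = fun=> 0).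
      by split; apply/funext => t; rewrite /Re_coord /Im_coord big1// => l _;
        rewrite mxE mul0r.
    by rewrite /decays !H0.1 !H0.2; split; exact: cvg_cst.
  move=> z zs; apply: hA; rewrite eigenvalue_root_char -/Ac sE root_prod_XsubC.
  exact: zs.
suff -> : Re_coord x (delta_mx 0 k) = (fun t => x t k 0) by [].
apply/funext => t; rewrite /Re_coord (bigD1 k)//= mxE !eqxx /= mul1r.
rewrite big1 ?addr0// => l lk.
by rewrite mxE (negbTE lk) andbF mul0r.
Qed.

(** * Quadratic forms and the graph matrix H *)

Lemma continuous_sum (R : realType) (T : topologicalType) (I : Type)
    (s : seq I) (f : I -> T -> R) :
  (forall i, continuous (f i)) -> continuous (fun x => \sum_(i <- s) f i x).
Proof.
move=> cf; elim: s => [|i s IH].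
  by under eq_fun do rewrite big_nil; move=> x; exact: cvg_cst.
by under eq_fun do rewrite big_cons; move=> x; apply: cvgD; [exact: cf|exact: IH].
Qed.

Lemma continuous_mul (R : realType) (T : topologicalType) (f g : T -> R) :
  continuous f -> continuous g -> continuous (fun x => f x * g x).
Proof. by move=> cf cg x; apply: cvgM; [exact: cf|exact: cg]. Qed.

Lemma continuous_scalar (R : realType) (T : topologicalType) (c : R) :
  continuous (fun _ : T => c).
Proof. by move=> x; exact: cvg_cst. Qed.

Definition qform (R : realType) n (A : 'M[R]_n) (x : 'rV[R]_n) : R :=
  (x *m A *m x^T) 0 0.

Lemma qform1 (R : realType) n (x : 'rV[R]_n) : qform 1%:M x = \sum_k x 0 k ^+ 2.
Proof. by rewrite /qform mulmx1 mxE; apply: eq_bigr => k _; rewrite mxE expr2. Qed.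

Lemma qformD (R : realType) n (A : 'M[R]_n) (x y : 'rV[R]_n) : A^T = A ->
  qform A (x + y) = qform A x + 2 * (x *m A *m y^T) 0 0 + qform A y.
Proof.
move=> sA; rewrite /qform linearD /= !mulmxDl !mulmxDr.
have -> : y *m A *m x^T = (x *m A *m y^T)^T.
  by rewrite !trmx_mul trmxK sA mulmxA.
have E (a b d : 'M[R]_1) :
    (a + b + (b^T + d)) 0 0 = a 0 0 + 2 * b 0 0 + d 0 0 by rewrite !mxE; ring.
exact: E.
Qed.

Lemma qformZ (R : realType) n (A : 'M[R]_n) (c : R) (x : 'rV[R]_n) :
  qform A (c *: x) = c ^+ 2 * qform A x.
Proof. by rewrite /qform linearZ /= -!scalemxAl -scalemxAr scalerA mxE expr2. Qed.

Lemma continuous_qform (R : realType) n (A : 'M[R]_n) : continuous (qform A).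
Proof.
have -> : qform A = fun x => \sum_j (\sum_i x 0 i * A i j) * x 0 j.
  by apply/funext => x; rewrite /qform mxE; apply: eq_bigr => j _; rewrite !mxE.
apply: continuous_sum => j; apply: continuous_mul; last exact: coord_continuous.
apply: continuous_sum => i; apply: continuous_mul; last exact: continuous_scalar.
exact: coord_continuous.
Qed.

(** First-order condition: [v] minimizes the form, so moving along a basis vector by any [s] gives 0
    <= 2 s b + s^2 B_kk, which forces the linear coefficient [b] to vanish. *)
Lemma psd_kernel (R : realType) n (B : 'M[R]_n) (v : 'rV[R]_n) : B^T = B ->
  (forall x, 0 <= qform B x) -> qform B v = 0 -> v *m B = 0.
Proof.
move=> sB B0 v0; apply/rowP => k; rewrite [RHS]mxE.
pose b := (v *m B) 0 k.
have delta_r (x : 'rV[R]_n) : (x *m delta_mx k 0) 0 0 = x 0 k.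
  rewrite mxE (bigD1 k)//= mxE !eqxx mulr1 big1 ?addr0// => i ik.
  by rewrite mxE (negbTE ik) mulr0.
have E1 s : (v *m B *m (s *: delta_mx 0 k)^T) 0 0 = s * b.
  by rewrite [(s *: _)^T]linearZ /= trmx_delta -scalemxAr [LHS]mxE delta_r.
have E2 : qform B (delta_mx 0 k) = B k k.
  rewrite /qform trmx_delta delta_r mxE (bigD1 k)//= mxE !eqxx mul1r.
  by rewrite big1 ?addr0// => i ik; rewrite mxE (negbTE ik) andbF mul0r.
have bE s : 0 <= 2 * s * b + s ^+ 2 * B k k.
  have := B0 (v + s *: delta_mx 0 k).
  by rewrite qformD// v0 add0r qformZ E1 E2 mulrA.
apply/eqP/negPn/negP => b0.
(* With [d] above [B k k], the displacement [- b / d] would make the form negative. *)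
pose d := `|B k k| + 1.
have d0 : 0 < d by rewrite ltr_pwDr.
have := bE (- b / d).
have -> : 2 * (- b / d) * b + (- b / d) ^+ 2 * B k k = b ^+ 2 / d * (B k k / d - 2).
  by field; rewrite gt_eqF.
rewrite pmulr_rge0; last by rewrite divr_gt0// exprn_even_gt0.
rewrite subr_ge0 ler_pdivlMr// /d; have := ler_norm (B k k).
have := normr_ge0 (B k k); lra.
Qed.

(** Minimize the form on the unit sphere, which is compact as a closed subset of a cube. Subtracting
    the minimum [m] leaves a nonnegative form that vanishes at the minimizer [v], and [psd_kernel]
    turns this into the eigenvector equation. *)
Lemma rayleigh_min (R : realType) n (A : 'M[R]_n.+1) : A^T = A ->
  exists m (v : 'rV[R]_n.+1), [/\ v != 0, v *m A = m *: v &
    forall x : 'rV[R]_n.+1, m * \sum_k x 0 k ^+ 2 <= qform A x].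
Proof.
move=> sA.
pose S := [set x : 'rV[R]_n.+1 | qform 1%:M x = 1].
have cS : compact S.
  apply: (@subclosed_compact _ _ [set x : 'rV[R]_n.+1 | forall i, x ord0 i \in `[(-1), 1]]).
  - have -> : S = qform 1%:M @^-1` [set x | x = 1] by [].
    by apply: closed_comp => [x _|]; [exact: continuous_qform|exact: closed_eq].
  - by apply: (@rV_compact R _ (fun=> `[(-1 : R), 1]%classic)) => _; exact: segment_compact.
  - move=> x; rewrite /S /= qform1 => x1 i; rewrite in_itv /= -ler_norml.
    rewrite -(@ler_pXn2r _ 2)// ?nnegrE// real_normK ?num_real// expr1n -x1.
    by rewrite (bigD1 i)//= lerDl sumr_ge0// => j _; exact: sqr_ge0.
have S0 : S !=set0.
  exists (delta_mx 0 0); rewrite /S /= qform1 (bigD1 0)//= mxE !eqxx expr1n.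
  by rewrite big1 ?addr0// => j j0; rewrite mxE (negbTE j0) andbF expr0n.
have [v] := EVT_min_rV S0 cS (continuous_subspaceT (@continuous_qform R _ A)).
rewrite inE => vS vmin; pose m := qform A v.
have mq x : m * qform 1%:M x <= qform A x.
  have [x0|x0] := eqVneq (qform 1%:M x) 0.
    have -> : x = 0.
      apply/rowP => k; rewrite mxE; apply/eqP; rewrite -sqrf_eq0.
      move/eqP: x0; rewrite qform1 psumr_eq0 => [/allP/(_ k)|j _]; last exact: sqr_ge0.
      by rewrite mem_index_enum => /(_ isT).
    by rewrite /qform !mul0mx mxE mulr0.
  have x1 : 0 < qform 1%:M x.
    by rewrite lt_neqAle eq_sym x0 qform1 sumr_ge0// => j _; exact: sqr_ge0.
  (* Rescales [x] onto the sphere, where minimality applies. *)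
  pose c := (Num.sqrt (qform 1%:M x))^-1.
  have c2 : c ^+ 2 = (qform 1%:M x)^-1 by rewrite exprVn sqr_sqrtr// ltW.
  have := vmin (c *: x); rewrite inE /S /= !qformZ c2 mulVf// => /(_ erefl).
  by rewrite mulrC ler_pdivlMr.
exists m, v; split=> [||x]; last by rewrite -qform1.
  apply: contra_eq_neq vS => ->; rewrite /qform !mul0mx mxE eq_sym; exact: oner_neq0.
pose B := A - m%:M.
have qB x : qform B x = qform A x - m * qform 1%:M x.
  rewrite /qform mulmxBr mulmxBl mul_mx_scalar -scalemxAl mulmx1 [LHS]mxE.
  by congr (_ + _); rewrite mxE; congr (- _); rewrite mxE.
have : v *m B = 0.
  apply: psd_kernel => [|x|]; last by rewrite qB vS mulr1 subrr.
    by rewrite linearB /= sA tr_scalar_mx.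
  by rewrite qB subr_ge0.
by rewrite mulmxBr mul_mx_scalar => /eqP; rewrite subr_eq0 => /eqP.
Qed.

Lemma smallest_eigenvalue_le (R : realType) n (A : 'M[R]_n) (l : R) : A^T = A ->
  smallest_eigenvalue A l -> forall x : 'rV[R]_n, l * \sum_k x 0 k ^+ 2 <= qform A x.
Proof.
case: n A => [|n] A sA [_ lmin] x.
  by rewrite big_ord0 mulr0 /qform mxE big_ord0.
have [m [v [v0 vA mP]]] := rayleigh_min sA; apply: le_trans (mP x).
rewrite ler_wpM2r ?sumr_ge0// => [k _|]; first exact: sqr_ge0.
by apply: lmin; apply/eigenvalueP; exists v.
Qed.

(** The constant is the minimum of the Rayleigh quotient; it is positive because it is attained at a
    nonzero vector. *)
Lemma posdef_coercive (R : realType) n (A : 'M[R]_n) : posdef A ->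
  exists2 c, 0 < c & forall x : 'cV[R]_n, c * \sum_k x k 0 ^+ 2 <= (x^T *m A *m x) 0 0.
Proof.
case: n A => [|n] A [sA A0].
  by exists 1 => // x; rewrite big_ord0 mulr0 mxE big_ord0.
have [m [v [v0 vA mP]]] := rayleigh_min sA; exists m => [|x].
  have vT0 : v^T != 0 by rewrite -(inj_eq (can_inj (@trmxK _ _ _))) trmxK trmx0.
  have := A0 _ vT0; rewrite trmxK vA -scalemxAl mxE -[v in v *m _]mulmx1.
  rewrite -/(qform _ _) qform1; apply: contraTT; rewrite -!leNgt => m0.
  by rewrite mulr_le0_ge0// sumr_ge0// => k _; exact: sqr_ge0.
have := mP x^T; rewrite /qform trmxK.
by under eq_bigr do rewrite mxE.
Qed.

Section Graph.
Variables (R : realType) (N : nat) (a : 'M[R]_N.+1).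
Hypothesis a_graph : comm_graph a.
Hypothesis a_connected : graph_connected a.

Lemma graph_H_sym : (graph_H a)^T = graph_H a.
Proof.
apply/matrixP => i j; rewrite !mxE !(inj_eq lift_inj) (eq_sym j).
by case: eqP => [->//|_]; congr (- _); apply: a_connected.2; rewrite eq_sym neq_lift.
Qed.

(** Deleting the leader's row and column amounts to giving the leader the value 0. This matches the
    coupling term of the control law, where errors are relative to the leader. A general [V] serves
    both scalars and error vectors. *)
Lemma graph_H_apply (V : lmodType R) (y : 'I_N -> V) i :
  \sum_j graph_H a i j *: y j =
  \sum_k a (lift ord0 i) k *: (y i - oapp y 0 (unlift ord0 k)).
Proof.
have [_ a0 _] := a_graph.
rewrite big_ord_recl unlift_none /= subr0.
under [in RHS]eq_bigr do rewrite liftK /= scalerBr.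
rewrite sumrB addrA -scaler_suml -scalerDl.
have -> : a (lift ord0 i) ord0 + \sum_j a (lift ord0 i) (lift ord0 j) =
    \sum_(k | k != lift ord0 i) a (lift ord0 i) k.
  by rewrite -big_ord_recl (bigD1 (lift ord0 i))//= a0 add0r.
rewrite (bigD1 i)//= [in RHS](bigD1 i)//= a0 scale0r add0r !mxE eqxx.
congr (_ + _); rewrite -sumrN; apply: eq_bigr => j ji.
by rewrite !mxE (inj_eq lift_inj) eq_sym (negbTE ji) scaleNr.
Qed.

Lemma qform_graph_H (y : 'rV[R]_N) :
  qform (graph_H a) y = \sum_i a (lift ord0 i) ord0 * y 0 i ^+ 2 +
    2^-1 * \sum_i \sum_j a (lift ord0 i) (lift ord0 j) * (y 0 i - y 0 j) ^+ 2.
Proof.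
have [_ a0 _] := a_graph; have [_ asym] := a_connected.
have sym i j : a (lift ord0 i) (lift ord0 j) = a (lift ord0 j) (lift ord0 i).
  by apply: asym; rewrite eq_sym neq_lift.
have -> : qform (graph_H a) y = \sum_i y 0 i * \sum_j graph_H a i j *: (y 0 j : R^o).
  rewrite /qform -mulmxA mxE; apply: eq_bigr => i _; congr (_ * _).
  by rewrite mxE; apply: eq_bigr => j _; rewrite [_^T _ _]mxE.
under eq_bigr do rewrite graph_H_apply big_ord_recl unlift_none /= subr0 mulrDr.
rewrite big_split /=; congr (_ + _).
  by apply: eq_bigr => i _; rewrite /GRing.scale /=; ring.
(* Symmetrization: adding to [T] its copy with [i] and [j] exchanged produces the squares (y_i -
   y_j)^2. *)
pose T := \sum_i \sum_j a (lift ord0 i) (lift ord0 j) * (y 0 i * (y 0 i - y 0 j)).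
have -> : \sum_i y 0 i * (\sum_(j < N) a (lift ord0 i) (lift ord0 j) *:
    (y 0 i - oapp (fun j => y 0 j : R^o) 0 (unlift ord0 (lift ord0 j)))) = T.
  apply: eq_bigr => i _; rewrite mulr_sumr; apply: eq_bigr => j _.
  by rewrite liftK /= /GRing.scale /=; ring.
have T' : T = \sum_i \sum_j a (lift ord0 i) (lift ord0 j) * (y 0 j * (y 0 j - y 0 i)).
  by rewrite /T exchange_big; apply: eq_bigr => i _; apply: eq_bigr => j _; rewrite sym.
suff -> : \sum_i \sum_j a (lift ord0 i) (lift ord0 j) * (y 0 i - y 0 j) ^+ 2 = T + T.
  by field.
rewrite {2}T' -big_split; apply: eq_bigr => i _ /=; rewrite -big_split.
by apply: eq_bigr => j _ /=; ring.
Qed.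

Lemma qform_graph_H_ge0 (y : 'rV[R]_N) : 0 <= qform (graph_H a) y.
Proof.
have [age0 _ _] := a_graph; rewrite qform_graph_H.
rewrite addr_ge0 ?mulr_ge0 ?invr_ge0//; first by apply: sumr_ge0 => i _; rewrite mulr_ge0 ?sqr_ge0.
by apply: sumr_ge0 => i _; apply: sumr_ge0 => j _; rewrite mulr_ge0 ?sqr_ge0.
Qed.

(** Every square in the sum-of-squares form vanishes, so two nodes joined by an edge have equal
    values; extended by 0 at the leader, the value 0 spreads along the directed paths from the
    leader. *)
Lemma qform_graph_H_eq0 (y : 'rV[R]_N) : qform (graph_H a) y = 0 -> y = 0.
Proof.
have [age0 _ a_leader] := a_graph; rewrite qform_graph_H => /eqP.
have t1 i : true -> 0 <= a (lift ord0 i) ord0 * y 0 i ^+ 2.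
  by rewrite mulr_ge0 ?sqr_ge0.
have t2 i j : true -> 0 <= a (lift ord0 i) (lift ord0 j) * (y 0 i - y 0 j) ^+ 2.
  by rewrite mulr_ge0 ?sqr_ge0.
rewrite paddr_eq0 ?mulr_ge0 ?invr_ge0 ?sumr_ge0//; last 1 first.
  by move=> i _; apply: sumr_ge0 => j _; exact: t2.
rewrite mulf_eq0 invr_eq0 pnatr_eq0 /= psumr_eq0// psumr_eq0; last first.
  by move=> i _; apply: sumr_ge0 => j _; exact: t2.
move=> /andP[/allP z1 /allP z2].
pose Y k := oapp (y 0) 0 (unlift ord0 k).
have step j i : edge a j i -> Y j = 0 -> Y i = 0.
  rewrite /edge /Y; case: (unliftP ord0 i) => [i' ->|-> _ _//].
  case: (unliftP ord0 j) => [j' ->|->] /= aij.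
    move=> yj; have := z2 i' (mem_index_enum _); rewrite psumr_eq0; last by move=> k _; exact: t2.
    move=> /allP/(_ j' (mem_index_enum _)); rewrite /= mulf_eq0 gt_eqF//= sqrf_eq0 yj subr0.
    by move/eqP.
  by move=> _; have := z1 i' (mem_index_enum _); rewrite /= mulf_eq0 gt_eqF//= sqrf_eq0 => /eqP.
have walk p j : Y j = 0 -> path (edge a) j p -> Y (last j p) = 0.
  by elim: p j => //= k p IH j Yj /andP[ejk]; apply: IH; exact: step ejk Yj.
apply/rowP => i; rewrite mxE.
have /connectP[p /walk] := a_connected.1 (lift ord0 i).
by rewrite {1}/Y unlift_none => /(_ erefl) + E; rewrite -E /Y liftK.
Qed.

Lemma smallest_eigenvalue_graph_H_gt0 (l : R) :
  smallest_eigenvalue (graph_H a) l -> 0 < l.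
Proof.
move=> [/eigenvalueP[v vH v0] _].
have q0 : qform (graph_H a) v != 0.
  by apply: contra v0 => /eqP/qform_graph_H_eq0/eqP.
have : 0 < qform (graph_H a) v by rewrite lt_neqAle eq_sym q0 qform_graph_H_ge0.
rewrite /qform vH -scalemxAl mxE -[v in v *m _]mulmx1.
rewrite -/(qform _ _) qform1; apply: contraTT; rewrite -!leNgt => l0.
by rewrite mulr_le0_ge0// sumr_ge0// => k _; exact: sqr_ge0.
Qed.

End Graph.

(** * Consensus errors *)

Lemma is_derive_coordP (R : realType) n (y : R -> 'cV[R]_n) (dy : 'cV[R]_n) (t : R) :
  is_derive t 1 y dy <-> forall k, is_derive t 1 (fun r => y r k 0) (dy k 0).
Proof.
split=> [[d <-] k|H].
  by apply: DeriveDef; [move/derivable_mxP : d; apply|rewrite derive_mx// mxE].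
have d : derivable y t 1.
  by apply/derivable_mxP => k j; rewrite ord1; have [] := H k.
apply: DeriveDef => //; rewrite derive_mx//; apply/matrixP => k j.
by rewrite ord1 mxE; have [_] := H k.
Qed.

Lemma is_derive_sum_fun (R : realType) n (f : 'I_n -> R -> R) (df : 'I_n -> R) (t : R) :
  (forall i, is_derive t 1 (f i) (df i)) ->
  is_derive t 1 (fun r => \sum_i f i r) (\sum_i df i).
Proof.
move=> H; have -> : (fun r => \sum_i f i r) = \sum_i f i.
  by apply/funext => r; rewrite fct_sumE.
exact: is_derive_sum.
Qed.

Lemma bilinE (R : realType) n (P : 'M[R]_n) (x y : 'cV[R]_n) :
  (x^T *m P *m y) 0 0 = \sum_i \sum_j x i 0 * P i j * y j 0.
Proof.
rewrite mxE exchange_big; apply: eq_bigr => j _ /=.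
by rewrite mxE mulr_suml; apply: eq_bigr => i _; rewrite mxE.
Qed.

Lemma bilinC (R : realType) n (P : 'M[R]_n) (x y : 'cV[R]_n) : P^T = P ->
  (x^T *m P *m y) 0 0 = (y^T *m P *m x) 0 0.
Proof.
move=> sP; have <- : (y^T *m P *m x)^T = x^T *m P *m y.
  by rewrite !trmx_mul trmxK sP mulmxA.
by rewrite [LHS]mxE.
Qed.

Lemma is_derive_quad (R : realType) n (P : 'M[R]_n) (y : R -> 'cV[R]_n)
    (dy : 'cV[R]_n) (t : R) : P^T = P -> is_derive t 1 y dy ->
  is_derive t 1 (fun r => ((y r)^T *m P *m y r) 0 0) (2 * ((y t)^T *m P *m dy) 0 0).
Proof.
move=> sP /is_derive_coordP dyk.
have -> : (fun r => ((y r)^T *m P *m y r) 0 0) =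
    (fun r => \sum_i \sum_j y r i 0 * P i j * y r j 0).
  by apply/funext => r; rewrite bilinE.
have -> : 2 * ((y t)^T *m P *m dy) 0 0 =
    \sum_i \sum_j (dy i 0 * P i j * y t j 0 + y t i 0 * P i j * dy j 0).
  rewrite mulrDl mul1r {1}bilinC// !bilinE -big_split; apply: eq_bigr => i _ /=.
  by rewrite -big_split.
apply: is_derive_sum_fun => i; apply: is_derive_sum_fun => j.
have di := dyk i; have dj := dyk j.
by apply: is_derive_eq; rewrite /GRing.scale /=; ring.
Qed.

Lemma quad_le (R : realType) n (P : 'M[R]_n) :
  exists2 p, 0 < p & forall x : 'cV[R]_n,
    (x^T *m P *m x) 0 0 <= p * \sum_k x k 0 ^+ 2.
Proof.
pose p := \sum_i \sum_j `|P i j|.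
have p0 : 0 <= p by apply: sumr_ge0 => i _; apply: sumr_ge0.
exists (p + 1) => [|x]; first by rewrite ltr_pwDr.
set q := \sum_k _; have q0 : 0 <= q by apply: sumr_ge0 => k _; exact: sqr_ge0.
apply: (@le_trans _ _ (p * q)); last by rewrite ler_wpM2r// lerDl.
have xq k : x k 0 ^+ 2 <= q.
  by rewrite /q (bigD1 k)//= lerDl sumr_ge0// => j _; exact: sqr_ge0.
rewrite bilinE mulr_suml ler_sum// => i _; rewrite mulr_suml ler_sum// => j _.
apply: (le_trans (ler_norm _)); rewrite !normrM mulrAC mulrC ler_wpM2l//.
rewrite -normrM ler_norml; apply/andP; split.
  have := xq i; have := xq j; have := sqr_ge0 (x i 0 + x j 0).
  rewrite !expr2; nra.
have := xq i; have := xq j; have := sqr_ge0 (x i 0 - x j 0).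
rewrite !expr2; nra.
Qed.

Lemma cvg_sum0 (R : realType) n (f : 'I_n -> R -> R) :
  (forall i, f i t @[t --> +oo] --> (0 : R)) ->
  \sum_i f i t @[t --> +oo] --> (0 : R).
Proof.
move=> f0; elim: (index_enum _) => [|i s IH].
  by under eq_fun do rewrite big_nil; exact: cvg_cst.
rewrite -[X in _ --> X](addr0 (0 : R)); under eq_fun do rewrite big_cons.
by apply: cvgD; [exact: f0|exact: IH].
Qed.

(** Both the decay rate and the disturbance term come from positive definiteness of the matrix
    inequality with margin [q]: half of [q] absorbs the cross term with [beta], the other half is
    left as decay of [W] and hence of [V]. *)
Lemma consensus_decay (R : realType) N n (S P : 'M[R]_n) (d : 'cV[R]_n)
    (H : 'M[R]_N) (gamma lambda : R) (delta : 'I_N -> R -> 'cV[R]_n)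
    (b : 'I_N -> 'cV[R]_n) (beta rho : 'I_N -> R -> R) :
  posdef P ->
  posdef (2%:R *: (P *m d *m d^T *m P) - (S^T *m P + P *m S)) ->
  0 < lambda -> 1 / lambda <= gamma ->
  (forall y : 'rV[R]_N, lambda * \sum_k y 0 k ^+ 2 <= qform H y) ->
  (forall i (t : R), 0 < t -> is_derive t 1 (delta i)
     (S *m delta i t
      + ((- (gamma *: (d^T *m P))) *m \sum_j H i j *: delta j t) 0 0 *: d
      + beta i t *: b i)) ->
  (forall i (t : R), 0 < t -> beta i t ^+ 2 <= rho i t) ->
  (forall i, rho i t @[t --> +oo] --> (0 : R)) ->
  forall i k, delta i t k 0 @[t --> +oo] --> (0 : R).
Proof.
move=> pP pQ l0 gl Hl ddelta betarho rho0.
have [sP _] := pP.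
have [p p0 Pp] := quad_le P.
have [c c0 Pc] := posdef_coercive pP.
have [q q0 Qq] := posdef_coercive pQ.
pose V t := \sum_i ((delta i t)^T *m P *m delta i t) 0 0.
pose W t := \sum_i \sum_k delta i t k 0 ^+ 2.
pose eta t i := ((delta i t)^T *m P *m d) 0 0.
pose dd i t := S *m delta i t
      + ((- (gamma *: (d^T *m P))) *m \sum_j H i j *: delta j t) 0 0 *: d
      + beta i t *: b i.
pose B i := \sum_k (P *m b i) k 0 ^+ 2.
have g1 : 1 <= gamma * lambda by rewrite -ler_pdivrMr.
have mxD (A A' : 'M[R]_1) : (A + A') 0 0 = A 0 0 + A' 0 0 by rewrite mxE.
have mxN (A : 'M[R]_1) : (- A) 0 0 = - A 0 0 by rewrite mxE.
have mxZ r (A : 'M[R]_1) : (r *: A) 0 0 = r * A 0 0 by rewrite mxE.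
have kE i t : ((- (gamma *: (d^T *m P))) *m \sum_j H i j *: delta j t) 0 0 =
    - gamma * \sum_j H i j * eta t j.
  rewrite mulNmx -scalemxAl mxN mxZ mulNr; congr (- (_ * _)).
  rewrite mulmx_sumr summxE; apply: eq_bigr => j _.
  by rewrite -scalemxAr mxZ /eta [in RHS]bilinC.
have dV (t : R) : 0 < t -> is_derive t 1 V
    (\sum_i 2 * ((delta i t)^T *m P *m dd i t) 0 0).
  by move=> t0; apply: is_derive_sum_fun => i; apply: is_derive_quad => //; exact: ddelta.
(* The part of V' due to S is rewritten as minus the definite form plus [2 * eta t i ^+ 2]; this
   excess is what the coupling has to compensate. *)
have ddE i t : 2 * ((delta i t)^T *m P *m dd i t) 0 0 =
    - ((delta i t)^T *m (2%:R *: (P *m d *m d^T *m P) - (S^T *m P + P *m S)) *m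
        delta i t) 0 0 + 2 * eta t i ^+ 2
    - 2 * gamma * (eta t i * \sum_j H i j * eta t j)
    + 2 * beta i t * \sum_k delta i t k 0 * (P *m b i) k 0.
  have E1 : ((delta i t)^T *m (P *m d *m d^T *m P) *m delta i t) 0 0 = eta t i ^+ 2.
    have -> : (delta i t)^T *m (P *m d *m d^T *m P) *m delta i t =
        ((delta i t)^T *m P *m d) *m (d^T *m P *m delta i t) by rewrite !mulmxA.
    by rewrite mxE big_ord1 expr2 /eta [X in _ * X]bilinC.
  have E2 : ((delta i t)^T *m (S^T *m P) *m delta i t) 0 0 =
      ((delta i t)^T *m P *m (S *m delta i t)) 0 0.
    by rewrite [RHS]bilinC// trmx_mul !mulmxA.
  have E3 : ((delta i t)^T *m (P *m S) *m delta i t) 0 0 =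
      ((delta i t)^T *m P *m (S *m delta i t)) 0 0 by rewrite !mulmxA.
  have E4 : ((delta i t)^T *m P *m b i) 0 0 = \sum_k delta i t k 0 * (P *m b i) k 0.
    by rewrite -mulmxA mxE; apply: eq_bigr => k _; rewrite mxE.
  have -> : ((delta i t)^T *m (2%:R *: (P *m d *m d^T *m P) - (S^T *m P + P *m S)) *m
      delta i t) 0 0 = 2 * eta t i ^+ 2 - 2 * ((delta i t)^T *m P *m (S *m delta i t)) 0 0.
    rewrite mulmxBr mulmxBl mulmxDr mulmxDl -scalemxAr -scalemxAl.
    by rewrite mxD mxN mxD mxZ E1 E2 E3; ring.
  rewrite /dd kE !mulmxDr -!scalemxAr !mxD !mxZ E4 -/(eta t i).
  ring.
have VW t : V t <= p * W t.
  by rewrite /V /W mulr_sumr ler_sum.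
have W0 t : 0 <= W t.
  by apply: sumr_ge0 => i _; apply: sumr_ge0 => k _; exact: sqr_ge0.
(* The Rayleigh bound for H applied to the row of all [eta t i], combined with
   [gamma * lambda >= 1]. *)
have etaH t : \sum_i eta t i ^+ 2 <= gamma * \sum_i (eta t i * \sum_j H i j * eta t j).
  have := Hl (\row_k eta t k); under eq_bigr do rewrite mxE.
  have -> : qform H (\row_k eta t k) = \sum_i (eta t i * \sum_j H i j * eta t j).
    rewrite /qform -mulmxA mxE; apply: eq_bigr => i _; rewrite !mxE; congr (_ * _).
    by apply: eq_bigr => j _; rewrite !mxE.
  have e0 : 0 <= \sum_i eta t i ^+ 2 by apply: sumr_ge0 => i _; exact: sqr_ge0.
  have ga0 : 0 <= gamma by rewrite (le_trans _ gl)// divr_ge0// ltW.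
  move=> /(ler_wpM2l ga0); apply: le_trans.
  by rewrite mulrA -[leLHS]mul1r ler_wpM2r.
have V0 : V t @[t --> +oo] --> (0 : R).
  apply: (@comparison_cvg0 R V (fun t => \sum_i 2 * ((delta i t)^T *m P *m dd i t) 0 0)
    (fun t => \sum_i (2 / q * B i) * rho i t) (q / 2 / p)) => //.
  - by rewrite !divr_gt0.
  - move=> t t0; under eq_bigr do rewrite ddE.
    have step : \sum_i (- ((delta i t)^T *m (2%:R *: (P *m d *m d^T *m P) -
          (S^T *m P + P *m S)) *m delta i t) 0 0 +
          2 * beta i t * \sum_k delta i t k 0 * (P *m b i) k 0)
        <= - (q / 2) * W t + \sum_i (2 / q * B i) * rho i t.
      rewrite /W mulr_sumr -big_split ler_sum// => i _ /=.
      have B0 : 0 <= B i by apply: sumr_ge0 => k _; exact: sqr_ge0.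
      (* Young's inequality coordinatewise, weighted so that exactly [q / 2] of the definite form is
         used up. *)
      have cross : 2 * beta i t * \sum_k delta i t k 0 * (P *m b i) k 0 <=
          q / 2 * \sum_k delta i t k 0 ^+ 2 + 2 / q * B i * beta i t ^+ 2.
        rewrite /B [2 / q * _]mulr_sumr [X in _ + X]mulr_suml !mulr_sumr -big_split.
        rewrite ler_sum// => k _ /=; rewrite -subr_ge0.
        set x := delta i t k 0; set y := (P *m b i) k 0; set z := beta i t.
        have -> : q / 2 * x ^+ 2 + 2 / q * y ^+ 2 * z ^+ 2 - 2 * z * (x * y) =
            (q * x - 2 * y * z) ^+ 2 / (2 * q).
          by field; rewrite gt_eqF.
        by rewrite divr_ge0 ?sqr_ge0// mulr_ge0// ltW.
      have := Qq (delta i t).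
      have : 2 / q * B i * beta i t ^+ 2 <= 2 / q * B i * rho i t.
        by rewrite ler_wpM2l ?betarho// mulr_ge0// divr_ge0// ltW.
      lra.
    have pVW : q / 2 / p * V t <= q / 2 * W t.
      rewrite -!mulrA ler_pM2l// ler_pM2l ?invr_gt0//.
      by rewrite mulrC ler_pdivrMr// mulrC.
    have := etaH t; move: step.
    have split4 (A E F G : 'I_N -> R) : \sum_i (- A i + 2 * E i - 2 * gamma * F i + G i) =
        \sum_i (- A i + G i) + 2 * \sum_i E i - 2 * gamma * \sum_i F i.
      rewrite 2!mulr_sumr -sumrN -!big_split; apply: eq_bigr => i _ /=; ring.
    rewrite split4; lra.
  - move=> t _; apply: sumr_ge0 => i _; apply: le_trans (Pc _).
    by rewrite mulr_ge0 ?(ltW c0)// sumr_ge0// => k _; exact: sqr_ge0.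
  - apply: cvg_sum0 => i; rewrite -(mulr0 (2 / q * B i)).
    exact: cvgMl_tmp.
move=> i k; apply: (@sqr_cvg0 R (fun t => c^-1 * V t)) => [t _|].
  rewrite mulrC ler_pdivlMr// /V (bigD1 i)//= -[leLHS]addr0 lerD//.
    apply: le_trans (Pc _); rewrite mulrC ler_pM2l// (bigD1 k)//= lerDl.
    by apply: sumr_ge0 => j _; exact: sqr_ge0.
  apply: sumr_ge0 => j _; apply: le_trans (Pc _).
  by rewrite mulr_ge0 ?(ltW c0)// sumr_ge0// => m _; exact: sqr_ge0.
rewrite -(mulr0 c^-1); exact: cvgMl_tmp.
Qed.

(** * Closed loop *)

Lemma ent_ord (R : realType) n (x : 'cV[R]_n) (j : 'I_n) : ent x j = x j 0.
Proof. by rewrite /ent valK. Qed.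

Lemma ent_out (R : realType) n (x : 'cV[R]_n) j : (n <= j)%N -> ent x j = 0.
Proof. by move=> nj; rewrite /ent insubF// ltnNge nj. Qed.

Lemma ent_lt (R : realType) n (x : 'cV[R]_n) j (jn : (j < n)%N) :
  ent x j = x (Ordinal jn) 0.
Proof. by rewrite -ent_ord. Qed.

Lemma ent_col_mx (R : realType) m n (x : 'cV[R]_m) (y : 'cV[R]_n) j :
  ent (col_mx x y) j = if (j < m)%N then ent x j else ent y (j - m).
Proof.
case: ltnP => jm.
  have -> : j = lshift n (Ordinal jm) by [].
  by rewrite ent_ord col_mxEu -ent_ord.
have [jn|jn] := ltnP j (m + n); last first.
  by rewrite !ent_out// leq_subRL.
have jmn : (j - m < n)%N by rewrite ltn_subLR.
have E : j = rshift m (Ordinal jmn) by rewrite /= subnKC.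
by rewrite {1}E ent_ord col_mxEd -ent_ord.
Qed.

Lemma ent_dsubmx (R : realType) m n (x : 'cV[R]_(m + n)) j :
  ent (dsubmx x) j = ent x (m + j).
Proof.
have [jn|jn] := ltnP j n; last by rewrite !ent_out// leq_add2l.
by have -> : j = Ordinal jn by []; rewrite ent_ord mxE -ent_ord.
Qed.

Lemma is_derive_ent (R : realType) n (y : R -> 'cV[R]_n) (dy : 'cV[R]_n) (t : R) j :
  is_derive t 1 y dy -> is_derive t 1 (fun r => ent (y r) j) (ent dy j).
Proof.
move=> /is_derive_coordP H; have [jn|jn] := ltnP j n.
  have E (x : 'cV[R]_n) : ent x j = x (Ordinal jn) 0 by rewrite -ent_ord.
  by rewrite E; under eq_fun do rewrite E; exact: H.
rewrite ent_out//; under eq_fun do rewrite ent_out//.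
exact: is_derive_cst.
Qed.

Lemma leader_S_mul (R : realType) n0 (s : 'rV[R]_n0) (y : 'cV[R]_n0) (j : 'I_n0) :
  (leader_S s *m y) j 0 =
    if j.+1 == n0 then \sum_k s 0 k * y k 0 else ent y j.+1.
Proof.
rewrite mxE; under eq_bigr do rewrite mxE.
case: eqP => // /eqP jn.
have jn' : (j.+1 < n0)%N by rewrite ltn_neqAle jn ltn_ord.
rewrite -[j.+1]/(val (Ordinal jn')) ent_ord (bigD1 (Ordinal jn'))//= eqxx mul1r.
rewrite big1 ?addr0// => k kj; rewrite (_ : (k == j.+1 :> nat) = false) ?mul0r//.
exact: negbTE kj.
Qed.

Section ClosedLoop.
Variables (R : realType) (N : nat) (ag : 'I_N -> agent R).
Variables (n0 : nat) (s : 'rV[R]_n0) (d0 : R) (a : 'M[R]_N.+1) (K : 'rV[R]_n0).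
Hypothesis nx_le : forall i, (nx (ag i) <= n0)%N.

Let state := composite_state ag n0 (red_nc ag n0).
Implicit Type X : state.

(** Holds for every natural [j]: from [n0] on, both sides are the default value 0 of [ent]. *)
Lemma ent_red_xhat X i j :
  ent (red_xhat X i) j =
    if (j < nx (ag i))%N then ent (st_x X i) j
    else ent (st_c X i) (nz (ag i) + (j - nx (ag i))).
Proof.
have [jn|jn] := ltnP j n0.
  by rewrite (ent_lt _ jn) mxE ent_col_mx ent_dsubmx.
rewrite ent_out// ltnNge (leq_trans (nx_le i))//= ent_out//.
by rewrite leq_add2l leq_sub2r.
Qed.

(** Merges the two cases of the law, shift and last equation, into row [j] of the leader's equation
    with coupling. The index [j.+1] appears because [red_next] at [j.+1] is the prescribed
    derivative of coordinate [j]. An agent with [nx] equal to [n0] needs no separate treatment. *)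
Lemma red_nextE X i (v : R) (j : 'I_n0) :
  red_next s d0 a K i v X j.+1 =
    (leader_S s *m red_xhat X i) j 0 +
    leader_d n0 d0 j 0 * (v + (K *m \sum_(k < N.+1)
       a (lift ord0 i) k *: (red_xhat X i - node_xhat X k)) 0 0).
Proof.
rewrite /red_next leader_S_mul /leader_d mxE.
have := ltn_ord j; rewrite leq_eqVlt; case: eqP => [jn _|jn /= ->].
  by rewrite jn ltnn /red_top; ring.
by rewrite mul0r addr0.
Qed.

Definition g_mismatch X (i : 'I_N) : R :=
  g (st_z X i) (st_x X i) - g (red_xi X i) (st_x X i).

Variables (v : R -> R) (X : R -> state).
Hypothesis X_traj : composite_trajectory s d0 (law := reduced_order_law ag s d0 a K) v X.

Lemma is_derive_red_xi i (t : R) : 0 < t ->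
  is_derive t 1 (fun r => red_xi (X r) i) (z_field (red_xi (X t) i) (st_x (X t) i)).
Proof.
move=> t0; have [_ _ /(_ i)[_ /(_ t t0) /is_derive_coordP dc] _] := X_traj.
apply/is_derive_coordP => k.
have := dc (lshift _ k); rewrite /= col_mxEu => D.
by under eq_fun do rewrite /red_xi mxE.
Qed.

Lemma is_derive_red_xhat i (t : R) : 0 < t ->
  is_derive t 1 (fun r => red_xhat (X r) i)
    (leader_S s *m red_xhat (X t) i
     + (v t + (K *m \sum_(k < N.+1)
         a (lift ord0 i) k *: (red_xhat (X t) i - node_xhat (X t) k)) 0 0)
         *: leader_d n0 d0
     + g_mismatch (X t) i *: \col_(j < n0) (j.+1 == nx (ag i))%:R).
Proof.
move=> t0; have [_ /(_ i)[_ /(_ t t0) dx] /(_ i)[_ /(_ t t0) dc] _] := X_traj.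
apply/is_derive_coordP => j.
have entry (A d b : 'cV[R]_n0) (r m : R) :
    (A + r *: d + m *: b) j 0 = A j 0 + d j 0 * r + m * b j 0.
  by rewrite !mxE; ring.
rewrite entry -red_nextE [(\col_ _ _) j 0]mxE.
have E Y : red_xhat Y i j 0 = ent (red_xhat Y i) j by rewrite ent_ord.
under eq_fun do rewrite E ent_red_xhat.
case: ltnP => jx.
  apply: is_derive_eq (is_derive_ent j dx) _.
  (* In the last plant coordinate, [j.+1 = nx], the input meets the true [g] and leaves the
     mismatch; the earlier coordinates are plain shifts. *)
  rewrite (ent_lt _ jx) mxE /=; move: jx; rewrite leq_eqVlt => /orP[/eqP jx|jx].
    rewrite jx ltnn eqxx mulr1 /g_mismatch /law_u /= /red_u; ring.
  rewrite jx (ltn_eqF jx) mulr0 addr0 /red_next (leq_trans jx)//.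
  by rewrite ent_red_xhat jx.
apply: is_derive_eq (is_derive_ent _ dc) _.
have jx' : (j - nx (ag i) < n0 - nx (ag i))%N by rewrite ltn_sub2r// (leq_ltn_trans jx).
rewrite /= ent_col_mx ltnNge leq_addr /= addKn (ent_lt _ jx') mxE /=.
by rewrite subnKC// gtn_eqF ?mulr0 ?addr0// ltnS.
Qed.

Lemma is_derive_st_w (t : R) : 0 < t ->
  is_derive t 1 (fun r => st_w (X r))
    (leader_S s *m st_w (X t) + v t *: leader_d n0 d0).
Proof. by move=> t0; have [_ _ _ [_ /(_ t t0)]] := X_traj. Qed.

(** The observer is driven by the same [x_i] as the plant, so the nonlinear term [f] cancels. *)
Lemma is_derive_observer_error i (t : R) : 0 < t ->
  is_derive t 1 (fun r => st_z (X r) i - red_xi (X r) i)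
    (A0 (ag i) *m (st_z (X t) i - red_xi (X t) i)).
Proof.
move=> t0; have [/(_ i)[_ /(_ t t0) dz] _ _ _] := X_traj.
apply: is_derive_eq (is_deriveB dz (is_derive_red_xi i t0)) _.
by rewrite /z_field mulmxBr opprD addrACA subrr addr0.
Qed.

Lemma is_derive_consensus_error i (t : R) : comm_graph a -> 0 < t ->
  is_derive t 1 (fun r => red_xhat (X r) i - st_w (X r))
    (leader_S s *m (red_xhat (X t) i - st_w (X t))
     + (K *m \sum_j graph_H a i j *: (red_xhat (X t) j - st_w (X t))) 0 0
         *: leader_d n0 d0
     + g_mismatch (X t) i *: \col_(j < n0) (j.+1 == nx (ag i))%:R).
Proof.
move=> ga t0.
apply: is_derive_eq (is_deriveB (is_derive_red_xhat i t0) (is_derive_st_w t0)) _.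
rewrite (graph_H_apply ga (fun j => red_xhat (X t) j - st_w (X t))).
have -> : \sum_k a (lift ord0 i) k *: (red_xhat (X t) i - st_w (X t) -
      oapp (fun j => red_xhat (X t) j - st_w (X t)) 0 (unlift ord0 k)) =
    \sum_k a (lift ord0 i) k *: (red_xhat (X t) i - node_xhat (X t) k).
  apply: eq_bigr => k _; congr (_ *: _); rewrite /node_xhat.
  case: (unlift ord0 k) => [j|] /=; last by rewrite subr0.
  by rewrite opprB addrA subrK.
rewrite mulmxBr scalerDl; apply/matrixP => j k; rewrite !mxE; ring.
Qed.

End ClosedLoop.

Lemma g_mismatch_sqr_le (R : realType) (N : nat) (ag : 'I_N -> agent R) (n0 : nat)
    (X : composite_state ag n0 (red_nc ag n0)) (i : 'I_N) (M : R) :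
  (forall (z Delta : 'cV[R]_(nz (ag i))) (x : 'cV[R]_(nx (ag i))),
      `|g (z + Delta) x - g z x| <= M * enorm Delta) ->
  g_mismatch X i ^+ 2 <= M ^+ 2 * \sum_k (st_z X i - red_xi X i) k 0 ^+ 2.
Proof.
move=> lip; have := lip (red_xi X i) (st_z X i - red_xi X i) (st_x X i).
rewrite [red_xi X i + _]addrC subrK => H.
rewrite -real_normK ?num_real//.
have := lerXn2r 2 (normr_ge0 _) (le_trans (normr_ge0 _) H) H.
by rewrite exprMn /enorm sqr_sqrtr// sumr_ge0// => k _; exact: sqr_ge0.
Qed.

(** The tracking error is coordinate 0 of the consensus error, since the output is the first state
    both for the agent and for the leader. The bound [rho] fed to [consensus_decay] is the squared
    observer error times the squared constant of (A3). *)
Lemma tracking_error_cvg0 (R : realType) (N : nat) (ag : 'I_N -> agent R)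
    (n0 : nat) (s : 'rV[R]_n0) (d0 : R) (a : 'M[R]_N.+1)
    (P : 'M[R]_n0) (gamma lambda : R) (v : R -> R)
    (X : R -> composite_state ag n0 (red_nc ag n0)) :
  (forall i, agent_wf (ag i)) -> comm_graph a -> graph_connected a ->
  (forall i, (nx (ag i) <= n0)%N) -> (forall i, g_lipschitz (ag i)) ->
  posdef P ->
  posdef (2%:R *: (P *m leader_d n0 d0 *m (leader_d n0 d0)^T *m P)
          - ((leader_S s)^T *m P + P *m leader_S s)) ->
  smallest_eigenvalue (graph_H a) lambda -> 1 / lambda <= gamma ->
  composite_trajectory s d0
    (law := reduced_order_law ag s d0 a (- (gamma *: ((leader_d n0 d0)^T *m P)))) v X ->
  forall i, tracking_error (X t) i @[t --> +oo] --> (0 : R).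
Proof.
move=> wf ga gconn nxle glip pP pQ leig gl traj i.
pose M i := sval (cid2 (glip i)).
pose rho i t := M i ^+ 2 * \sum_k (st_z (X t) i - red_xi (X t) i) k 0 ^+ 2.
have nx1 : (0 < nx (ag i))%N by have [] := wf i.
have n00 : (0 < n0)%N by apply: leq_trans (nxle i).
have E t : tracking_error (X t) i =
    (red_xhat (X t) i - st_w (X t)) (Ordinal n00) 0.
  have subE (A B : 'cV[R]_n0) k : (A - B) k 0 = A k 0 - B k 0 by rewrite !mxE.
  rewrite /tracking_error /agent_output /leader_output subE.
  have -> : red_xhat (X t) i (Ordinal n00) 0 = ent (st_x (X t) i) 0.
    by rewrite -ent_lt ent_red_xhat// nx1.
  congr (_ - _); rewrite mxE (bigD1 (Ordinal n00))//= !mxE eqxx mul1r.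
  rewrite big1 ?addr0// => k k0; rewrite !mxE (_ : (k == 0%N :> nat) = false) ?mul0r//.
  exact: negbTE k0.
under eq_fun do rewrite E.
apply: (consensus_decay (beta := fun j t => g_mismatch (X t) j) (rho := rho)
  pP pQ (smallest_eigenvalue_graph_H_gt0 ga gconn leig) gl
  (smallest_eigenvalue_le (graph_H_sym gconn) leig)
  (fun j t t0 => is_derive_consensus_error nxle traj j ga t0)).
- move=> j t t0; apply: g_mismatch_sqr_le.
  by rewrite /M; case: (cid2 (glip j)).
- move=> j; have [_ hA _ _] := wf j.
  have eps0 := hurwitz_decay hA (fun t t0 => is_derive_observer_error traj j t0).
  rewrite -(mulr0 (M j ^+ 2)); apply: cvgMl_tmp; apply: cvg_sum0 => k.
  rewrite -[X in _ --> X](mulr0 (0 : R)); under eq_fun do rewrite expr2.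
  by apply: cvgM; exact: eps0.
Qed.

(** * Global existence *)

Lemma continuous_locally_lipschitz (R : realType) (I : finType)
    (G : (I -> R) -> R) (X : R -> I -> R) :
  (forall r : R, exists2 L : R, 0 <= L & forall Y Z (e : R),
     (forall j, `|Y j| <= r) -> (forall j, `|Z j| <= r) ->
     (forall j, `|Y j - Z j| <= e) -> `|G Y - G Z| <= L * e) ->
  (forall i, continuous (X^~ i)) -> continuous (fun t => G (X t)).
Proof.
move=> lipG cX t; apply/cvgrPdist_lt => /= e e0.
(* The extra 1 keeps nearby points of the path inside the box, as [d <= 1]. *)
pose r := \sum_j `|X t j| + 1.
have [L L0 LG] := lipG r.
pose d := Num.min 1 (e / (L + 1)).
have L1 : 0 < L + 1 by rewrite ltr_pwDr.
have d0 : 0 < d by rewrite lt_min ltr01 divr_gt0.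
have near_t : \forall u \near t, forall j, `|X t j - X u j| < d.
  apply: (@filter_forall R I (fun j u => `|X t j - X u j| < d) (nbhs t)) => j.
  by have /cvgrPdist_lt/(_ d d0) := cX j t.
near=> u.
have tu : forall j, `|X t j - X u j| < d by near: u.
have d1 : d <= 1 by rewrite ge_min lexx.
have de : d <= e / (L + 1) by rewrite ge_min lexx orbT.
have tr j : `|X t j| <= r - 1.
  by rewrite addrK (bigD1 j)//= lerDl sumr_ge0.
apply: (@le_lt_trans _ _ (L * d)).
  apply: LG => j; [have := tr j; lra| |exact: ltW].
  have := tr j; have := tu j; have := ler_normB (X t j) (X t j - X u j).
  rewrite subKr; lra.
apply: (@le_lt_trans _ _ (L * (e / (L + 1)))); first by rewrite ler_wpM2l.
by rewrite mulrA ltr_pdivrMr// mulrC ltr_pM2l// ltrDl.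
Unshelve. all: by end_near. Qed.

(* The block I2 is driven by the block I1, whose own growth is at most linear
   whatever the state of I2; so blow-up is excluded although the dependence on
   I1 is only locally Lipschitz. *)
Theorem cascade_solution (R : realType) (I1 I2 : finType)
    (G : (I1 + I2 -> R) -> I1 + I2 -> R) (b x0 : I1 + I2 -> R) (v : R -> R) (l : R) :
  continuous v -> (forall t, `|v t| <= l) ->
  (exists2 L : R, 0 <= L & forall Y (r : R), (forall j, `|Y (inl j)| <= r) ->
     forall i, `|G Y (inl i)| <= L * r + L) ->
  (exists2 L : R, 0 <= L & forall r : R, exists2 B : R, 0 <= B & forall Y (rho : R),
     (forall j, `|Y (inl j)| <= r) -> (forall j, `|Y (inr j)| <= rho) ->
     forall i, `|G Y (inr i)| <= L * rho + B) ->
  (forall i (r : R), exists2 L : R, 0 <= L & forall Y Z (e : R),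
     (forall j, `|Y j| <= r) -> (forall j, `|Z j| <= r) ->
     (forall j, `|Y j - Z j| <= e) -> `|G Y i - G Z i| <= L * e) ->
  exists X : R -> I1 + I2 -> R, [/\ X 0 = x0, forall i, continuous (X^~ i) &
      forall (t : R) i, 0 < t -> is_derive t 1 (X^~ i) (G (X t) i + v t * b i)].
Proof.
move=> cv vl [L1 L10 G1] [L2 L20 G2] lipG.
have l0 : 0 <= l by apply: le_trans (normr_ge0 _) (vl 0).
apply: (@picard_lindelof R _ (fun t Y i => G Y i + v t * b i) x0).
  move=> X cX i t; apply: cvgD.
    exact: (@continuous_locally_lipschitz R _ (fun Y => G Y i) X (lipG i) cX t).
  by apply: cvgMr_tmp; exact: cv.
move=> T T0.
pose D := l * \sum_i `|b i|.
have D0 : 0 <= D by rewrite mulr_ge0 ?sumr_ge0.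
have vb t i : `|v t * b i| <= D.
  rewrite normrM ler_pM// (bigD1 i)//= lerDl sumr_ge0//.
pose C1 := \sum_i `|x0 i| + L1 + D + 1.
(* The rate pays for the linear growth of both blocks; the summand 1 pays for the additive
   constants, which the sizes [C1] and [C2] dominate. It does not depend on [T], so no circularity
   arises in the choices below. *)
pose c := L1 + L2 + 1.
have cE x : c * x = L1 * x + L2 * x + x by rewrite /c; ring.
have c0 : 0 < c by rewrite ltr_pwDr// addr_ge0.
have s0 : 0 <= \sum_i `|x0 i| by apply: sumr_ge0.
(* The cascade order: the first block is confined up to time [T] before the drive [B] of the second
   block is fixed, and [C2] is chosen last. *)
have [B B0 GB] := G2 (C1 * expR (c * T)).
pose C2 := \sum_i `|x0 i| + B + D + 1.
have C10 : 0 <= C1 by rewrite !addr_ge0.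
have C20 : 0 <= C2 by rewrite !addr_ge0.
pose C (i : I1 + I2) := match i with inl _ => C1 | inr _ => C2 end.
pose r := (C1 + C2) * expR (c * T).
pose L := \sum_i sval (cid2 (lipG i r)) + 1.
have Li i : 0 <= sval (cid2 (lipG i r)) by case: (cid2 (lipG i r)).
have x0s i : `|x0 i| <= \sum_j `|x0 j| by rewrite (bigD1 i)//= lerDl sumr_ge0.
have in_box t Y : 0 <= t <= T -> in_region C c t Y -> forall j, `|Y j| <= r.
  move=> /andP[t0 tT] YC j; apply: (le_trans (YC j)); rewrite /r ler_pM ?expR_ge0//.
  - by case: j.
  - by case: j => j; rewrite /C ?lerDl ?lerDr.
  - by rewrite ler_expR ler_pM2l.
exists C, c, L; split=> //.
- by rewrite ltr_pwDr// sumr_ge0.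
- by move=> i; apply: (le_trans (x0s i)); case: i => i; rewrite /C /C1 /C2; lra.
- move=> t Y /andP[t0 tT] YC i.
  have ex1 : 1 <= expR (c * t) by rewrite -expR0 ler_expR mulr_ge0// ltW.
  have exT : expR (c * t) <= expR (c * T) by rewrite ler_expR ler_pM2l.
  apply: le_trans (ler_normD _ _) _; have := vb t i.
  case: i => i vbi; rewrite /C.
    have H := G1 Y (C1 * expR (c * t)) (fun j => YC (inl j)) i.
    have : L1 + D <= C1 * expR (c * t) by apply: (@le_trans _ _ C1); rewrite ?ler_peMr// /C1; lra.
    have : 0 <= L2 * (C1 * expR (c * t)) by rewrite !mulr_ge0// expR_ge0.
    move=> h1 h2; rewrite -mulrA [leRHS]cE; lra.
  have H1 j : `|Y (inl j)| <= C1 * expR (c * T).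
    by apply: (le_trans (YC (inl j))); rewrite ler_wpM2l.
  have H := GB Y (C2 * expR (c * t)) H1 (fun j => YC (inr j)) i.
  have : B + D <= C2 * expR (c * t) by apply: (@le_trans _ _ C2); rewrite ?ler_peMr// /C2; lra.
  have : 0 <= L1 * (C2 * expR (c * t)) by rewrite !mulr_ge0// expR_ge0.
  move=> h1 h2; rewrite -mulrA [leRHS]cE; lra.
- move=> t Y Z e tT YC ZC YZ i.
  rewrite opprD addrACA subrr addr0.
  have e0 : 0 <= e by apply: le_trans (normr_ge0 _) (YZ i).
  have H : `|G Y i - G Z i| <= sval (cid2 (lipG i r)) * e.
    case: (cid2 (lipG i r)) => L' _ /=; apply => //.
      exact: in_box YC.
    exact: in_box ZC.
  apply: (le_trans H); rewrite ler_wpM2r// /L (bigD1 i)//= -addrA lerDl.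
  by rewrite addr_ge0// sumr_ge0// => j _; exact: Li.
Qed.

Lemma finite_bound (R : realType) (I : finType) (P : I -> R -> Prop) :
  (forall i (x y : R), x <= y -> P i x -> P i y) ->
  (forall i, exists x, P i x) -> exists2 x, 0 <= x & forall i, P i x.
Proof.
move=> mono ex; pose c i := sval (cid (ex i)).
exists (\sum_i `|c i|) => [|i]; first exact: sumr_ge0.
apply: (mono i (c i)); last exact: svalP (cid (ex i)).
by apply: (le_trans (ler_norm _)); rewrite (bigD1 i)//= lerDl sumr_ge0.
Qed.

(** * Lipschitz functions of a selected block of coordinates *)

Section LipschitzOn.
Variables (R : realType) (I : Type) (D : set (I -> R)) (Q : I -> Prop).

(** Distances are measured on the coordinates in [Q] only, so on [setT] the property also says that
    [phi] depends on that block alone. The set [D] is a box for local estimates and [setT] for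
    growth bounds. *)
Definition lipschitz_on (phi : (I -> R) -> R) : Prop :=
  exists2 L : R, 0 <= L & forall Y Z (e : R), D Y -> D Z ->
    (forall j, Q j -> `|Y j - Z j| <= e) -> `|phi Y - phi Z| <= L * e.

Lemma lipschitz_on_ext phi psi :
  (forall Y, psi Y = phi Y) -> lipschitz_on phi -> lipschitz_on psi.
Proof. by move=> E; have -> : psi = phi by apply/funext. Qed.

Lemma lipschitz_on_coord j : Q j -> lipschitz_on (fun Y => Y j).
Proof. by move=> Qj; exists 1 => // Y Z e _ _ YZ; rewrite mul1r; exact: YZ. Qed.

Lemma lipschitz_on_const c : lipschitz_on (fun=> c).
Proof. by exists 0 => // Y Z e _ _ _; rewrite subrr normr0 mul0r. Qed.

Lemma lipschitz_onD phi psi : lipschitz_on phi -> lipschitz_on psi ->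
  lipschitz_on (fun Y => phi Y + psi Y).
Proof.
move=> [L L0 LP] [M M0 MP]; exists (L + M) => [|Y Z e DY DZ YZ]; first exact: addr_ge0.
rewrite opprD addrACA mulrDl (le_trans (ler_normD _ _))// lerD//.
  exact: LP.
exact: MP.
Qed.

Lemma lipschitz_onZ c phi : lipschitz_on phi -> lipschitz_on (fun Y => c * phi Y).
Proof.
move=> [L L0 LP]; exists (`|c| * L) => [|Y Z e DY DZ YZ]; first exact: mulr_ge0.
by rewrite -mulrBr normrM -mulrA ler_wpM2l// LP.
Qed.

Lemma lipschitz_on_sum (J : Type) (r : seq J) (phi : J -> (I -> R) -> R) :
  (forall j, lipschitz_on (phi j)) -> lipschitz_on (fun Y => \sum_(j <- r) phi j Y).
Proof.
move=> H; elim: r => [|j r IH].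
  by under eq_fun do rewrite big_nil; exact: lipschitz_on_const.
by under eq_fun do rewrite big_cons; exact: lipschitz_onD.
Qed.

Lemma lipschitz_on_mulmx m n (A : 'M[R]_(m, n)) (y : (I -> R) -> 'cV[R]_n) i :
  (forall k, lipschitz_on (fun Y => y Y k 0)) -> lipschitz_on (fun Y => (A *m y Y) i 0).
Proof.
move=> H; under eq_fun do rewrite mxE.
by apply: lipschitz_on_sum => k; exact: lipschitz_onZ.
Qed.

End LipschitzOn.

(** * The closed loop written as a cascade *)

Section Existence.
Variables (R : realType) (N : nat) (ag : 'I_N -> agent R).
Variables (n0 : nat) (s : 'rV[R]_n0) (d0 : R) (a : 'M[R]_N.+1) (K : 'rV[R]_n0).
Hypothesis ag_wf : forall i, agent_wf (ag i).
Hypothesis nx_le : forall i, (nx (ag i) <= n0)%N.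
Hypothesis g_lip : forall i, g_lipschitz (ag i).

Let state := composite_state ag n0 (red_nc ag n0).
Let Iz : finType := {i : 'I_N & 'I_(nz (ag i))}.
Let I1 : finType := ('I_n0 + 'I_N * 'I_n0 + Iz)%type.
Let I2 : finType := Iz.
Let ix : Type := (I1 + I2)%type.

Definition ix_w (j : 'I_n0) : ix := inl (inl (inl j)).
Definition ix_xhat (i : 'I_N) (j : 'I_n0) : ix := inl (inl (inr (i, j))).
Definition ix_eps (i : 'I_N) (k : 'I_(nz (ag i))) : ix :=
  inl (inr (Tagged (fun i => 'I_(nz (ag i))) k)).
Definition ix_xi (i : 'I_N) (k : 'I_(nz (ag i))) : ix :=
  inr (Tagged (fun i => 'I_(nz (ag i))) k).

(* Coordinates of the closed loop: the leader state, the extended agent states,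
   the observer errors z - xi, and (the nonlinearly driven block) xi. *)
Definition assemble (Y : ix -> R) : state :=
  let xh i : 'cV[R]_n0 := \col_j Y (ix_xhat i j) in
  CompositeState
    (fun i => \col_k (Y (ix_eps k) + Y (ix_xi k)))
    (fun i => \col_(j < nx (ag i)) ent (xh i) j)
    (fun i => col_mx (\col_k Y (ix_xi k))
                (\col_(k < n0 - nx (ag i)) ent (xh i) (nx (ag i) + k)))
    (\col_j Y (ix_w j)).

Definition coordinates (X : state) (i : ix) : R :=
  match i with
  | inl (inl (inl j)) => st_w X j 0
  | inl (inl (inr (i, j))) => red_xhat X i j 0
  | inl (inr p) => (st_z X (tag p) - red_xi X (tag p)) (tagged p) 0
  | inr p => red_xi X (tag p) (tagged p) 0
  end.

(** The time-independent part of the closed loop. The leader's input is split off into [loop_input],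
    the shape that [cascade_solution] expects. *)
Definition loop_field (Y : ix -> R) (i : ix) : R :=
  let X := assemble Y in
  match i with
  | inl (inl (inl j)) => (leader_S s *m st_w X) j 0
  | inl (inl (inr (i, j))) =>
      (leader_S s *m red_xhat X i) j 0
      + leader_d n0 d0 j 0 * (K *m \sum_(k < N.+1)
          a (lift ord0 i) k *: (red_xhat X i - node_xhat X k)) 0 0
      + (j.+1 == nx (ag i))%:R * g_mismatch X i
  | inl (inr p) => (A0 (ag (tag p)) *m (st_z X (tag p) - red_xi X (tag p))) (tagged p) 0
  | inr p => z_field (red_xi X (tag p)) (st_x X (tag p)) (tagged p) 0
  end.

Definition loop_input (i : ix) : R :=
  match i with
  | inl (inl (inl j)) | inl (inl (inr (_, j))) => leader_d n0 d0 j 0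
  | _ => 0
  end.

Lemma assemble_red_xhat Y i : red_xhat (assemble Y) i = \col_j Y (ix_xhat i j).
Proof.
apply/colP => j; rewrite -[LHS]ent_ord ent_red_xhat//= -[RHS]ent_ord.
case: ltnP => jx; first by rewrite (ent_lt _ jx) mxE.
have jx' : (j - nx (ag i) < n0 - nx (ag i))%N by rewrite ltn_sub2r// (leq_ltn_trans jx).
by rewrite ent_col_mx ltnNge leq_addr /= addKn (ent_lt _ jx') mxE /= subnKC.
Qed.

Lemma assemble_red_xi Y i : red_xi (assemble Y) i = \col_k Y (ix_xi k).
Proof. by rewrite /red_xi /= col_mxKu. Qed.

Lemma assemble_st_x Y i (j : 'I_(nx (ag i))) :
  st_x (assemble Y) i j 0 = Y (ix_xhat i (widen_ord (nx_le i) j)).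
Proof. by rewrite mxE -[j : nat]/(val (widen_ord (nx_le i) j)) ent_ord mxE. Qed.

Lemma assemble_st_w Y j : st_w (assemble Y) j 0 = Y (ix_w j).
Proof. by rewrite mxE. Qed.

Lemma assemble_eps Y i k :
  (st_z (assemble Y) i - red_xi (assemble Y) i) k 0 = Y (ix_eps k).
Proof. by rewrite assemble_red_xi !mxE addrK. Qed.

(** Makes every prescribed initial state attainable: a solution started at its coordinates assembles
    to it at time 0. *)
Lemma coordinatesK : cancel coordinates assemble.
Proof.
case=> z x c w; rewrite /assemble; f_equal.
- apply/functional_extensionality_dep => i; apply/colP => k.
  by rewrite !mxE /= !mxE subrK.
- apply/functional_extensionality_dep => i; apply/colP => j.
  rewrite mxE -[j : nat]/(val (widen_ord (nx_le i) j)) ent_ord mxE /=.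
  by rewrite -[LHS]ent_ord ent_red_xhat//= ltn_ord ent_ord.
- apply/functional_extensionality_dep => i; apply/colP => k.
  rewrite -[RHS]ent_ord -[in RHS](vsubmxK (c i)) -[LHS]ent_ord !ent_col_mx.
case: ltnP => kz; first by rewrite (ent_lt _ kz) mxE (ent_lt _ kz).
  have kz' : (k - nz (ag i) < n0 - nx (ag i))%N.
    by rewrite ltn_subLR// ltn_ord.
  rewrite ent_dsubmx subnKC// (ent_lt _ kz') mxE /=.
  have kx : (nx (ag i) + (k - nz (ag i)) < n0)%N.
    by rewrite -ltn_subRL.
  rewrite (ent_lt _ kx) mxE /= -ent_lt ent_red_xhat//=.
  by rewrite ltnNge leq_addr /= addKn subnKC.
- by apply/colP => j; rewrite mxE.
Qed.

Lemma lipschitz_on_assemble (D : set (ix -> R)) (Q : ix -> Prop) :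
  [/\ forall j, Q (ix_w j) -> lipschitz_on D Q (fun Y => st_w (assemble Y) j 0),
      forall i j, Q (ix_xhat i j) ->
        lipschitz_on D Q (fun Y => red_xhat (assemble Y) i j 0),
      forall i k, Q (@ix_eps i k) -> lipschitz_on D Q
        (fun Y => (st_z (assemble Y) i - red_xi (assemble Y) i) k 0) &
      forall i k, Q (@ix_xi i k) ->
        lipschitz_on D Q (fun Y => red_xi (assemble Y) i k 0)].
Proof.
split=> [j|i j|i k|i k] q.
- by under eq_fun do rewrite assemble_st_w; exact: lipschitz_on_coord.
- by under eq_fun do rewrite assemble_red_xhat mxE; exact: lipschitz_on_coord.
- by under eq_fun do rewrite assemble_eps; exact: lipschitz_on_coord.
- by under eq_fun do rewrite assemble_red_xi mxE; exact: lipschitz_on_coord.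
Qed.

Lemma lipschitz_on_loop_linear D (Q : ix -> Prop) i (j : 'I_n0) :
  (forall j, Q (ix_w j)) -> (forall i j, Q (ix_xhat i j)) ->
  lipschitz_on D Q (fun Y => (leader_S s *m red_xhat (assemble Y) i) j 0
      + leader_d n0 d0 j 0 * (K *m \sum_(k < N.+1) a (lift ord0 i) k *:
          (red_xhat (assemble Y) i - node_xhat (assemble Y) k)) 0 0).
Proof.
move=> Qw Qx.
have lx i' k : lipschitz_on D Q (fun Y => red_xhat (assemble Y) i' k 0).
  by have [_ + _ _] := lipschitz_on_assemble D Q; exact.
apply: lipschitz_onD; first exact: lipschitz_on_mulmx.
apply: lipschitz_onZ; apply: lipschitz_on_mulmx => k.
under eq_fun do rewrite summxE; apply: lipschitz_on_sum => m.
have E (A B : 'cV[R]_n0) r : (r *: (A - B)) k 0 = r * (A k 0 + (-1) * B k 0).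
  by rewrite !mxE mulN1r.
under eq_fun do rewrite E.
apply: lipschitz_onZ; apply: lipschitz_onD => //; apply: lipschitz_onZ.
rewrite /node_xhat; case: (unlift ord0 m) => [i'|] /=; first exact: lx.
by have [+ _ _ _] := lipschitz_on_assemble D Q; exact.
Qed.

(** Only the observer errors are bounded here: the constant of (A3) is uniform in [x] and in the
    base point, so [xhat] and [xi] may be arbitrary. This keeps the growth of the first block
    independent of [xi]. *)
Lemma assemble_mismatch_le Y i (r : R) M : 0 <= r -> 0 <= M ->
  (forall (z Delta : 'cV[R]_(nz (ag i))) (x : 'cV[R]_(nx (ag i))),
      `|g (z + Delta) x - g z x| <= M * enorm Delta) ->
  (forall k : 'I_(nz (ag i)), `|Y (ix_eps k)| <= r) ->
  `|g_mismatch (assemble Y) i| <= M * (nz (ag i))%:R * r.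
Proof.
move=> r0 M0 lip Yr; rewrite -(@ler_pXn2r _ 2)// ?nnegrE ?mulr_ge0//.
rewrite real_normK ?num_real//.
apply: le_trans (g_mismatch_sqr_le _ lip) _.
have -> : (M * (nz (ag i))%:R * r) ^+ 2 = M ^+ 2 * ((nz (ag i))%:R ^+ 2 * r ^+ 2) by ring.
rewrite ler_wpM2l ?sqr_ge0//.
apply: (@le_trans _ _ ((nz (ag i))%:R * r ^+ 2)).
  apply: sum_le_const => k; rewrite assemble_eps -real_normK ?num_real//.
  by rewrite ler_pXn2r ?nnegrE.
rewrite ler_wpM2r ?sqr_ge0// -natrX ler_nat expnS expn1.
by case: (nz (ag i)) => // n; rewrite leq_pmulr.
Qed.

Lemma assemble_st_x_box Y i (r : R) :
  (forall i j, `|Y (ix_xhat i j)| <= r) -> box r (st_x (assemble Y) i).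
Proof. by move=> Yr j; rewrite assemble_st_x. Qed.

Lemma lipschitz_on_mismatch (r : R) i :
  lipschitz_on [set Y : ix -> R | forall j, `|Y j| <= r] (fun=> True)
    (fun Y => g_mismatch (assemble Y) i).
Proof.
have [nx1 _ _ sg] := ag_wf i.
(* The radius is doubled because [z] is reassembled as eps + xi; for the same reason [z] may move by
   [2 * e]. *)
have [L L0 LP] := smooth2_lipschitz_box (`|r| + `|r|) sg.
have rr : r <= `|r| + `|r| by apply: (le_trans (ler_norm r)); rewrite lerDl.
exists (L * 2 + L) => [|Y Z e Yr Zr YZ]; first by rewrite addr_ge0// mulr_ge0.
have bx W : (forall j, `|W j| <= r) -> box (`|r| + `|r|) (st_x (assemble W) i).
  by move=> Wr; apply: assemble_st_x_box => ? ?; exact: le_trans (Wr _) rr.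
have bxi W : (forall j, `|W j| <= r) -> box (`|r| + `|r|) (red_xi (assemble W) i).
  by move=> Wr k; rewrite assemble_red_xi mxE; exact: le_trans (Wr _) rr.
have bz W : (forall j, `|W j| <= r) -> box (`|r| + `|r|) (st_z (assemble W) i).
  move=> Wr k; rewrite mxE (le_trans (ler_normD _ _))// lerD//;
    exact: le_trans (Wr _) (ler_norm r).
have dx j : `|st_x (assemble Y) i j 0 - st_x (assemble Z) i j 0| <= e.
  by rewrite !assemble_st_x; exact: YZ.
(* Nonnegativity of [e] is read off an actual coordinate, which exists because [nx] is at least
   1. *)
have e0 : 0 <= e := le_trans (normr_ge0 _) (dx (Ordinal nx1)).
have dx2 j : `|st_x (assemble Y) i j 0 - st_x (assemble Z) i j 0| <= 2 * e.
  by apply: (le_trans (dx j)); lra.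
have dxi k : `|red_xi (assemble Y) i k 0 - red_xi (assemble Z) i k 0| <= e.
  by rewrite !assemble_red_xi !mxE; exact: YZ.
have dz k : `|st_z (assemble Y) i k 0 - st_z (assemble Z) i k 0| <= 2 * e.
  rewrite !mxE opprD addrACA (le_trans (ler_normD _ _))//.
  by rewrite mulrDl mul1r lerD// YZ.
have H1 := LP _ _ _ _ _ (bz _ Yr) (bz _ Zr) (bx _ Yr) (bx _ Zr) dz dx2.
have H2 := LP _ _ _ _ _ (bxi _ Yr) (bxi _ Zr) (bx _ Yr) (bx _ Zr) dxi dx.
rewrite /g_mismatch mulrDl -[L * 2 * e]mulrA.
rewrite (_ : _ - _ = (g (st_z (assemble Y) i) (st_x (assemble Y) i) -
    g (st_z (assemble Z) i) (st_x (assemble Z) i)) -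
    (g (red_xi (assemble Y) i) (st_x (assemble Y) i) -
     g (red_xi (assemble Z) i) (st_x (assemble Z) i))); last by ring.
by rewrite (le_trans (ler_normB _ _))// lerD.
Qed.

Lemma lipschitz_on_loop_field (r : R) i :
  lipschitz_on [set Y : ix -> R | forall j, `|Y j| <= r] (fun=> True)
    (fun Y => loop_field Y i).
Proof.
have [lw lx leps lxi] := lipschitz_on_assemble
  [set Y : ix -> R | forall j, `|Y j| <= r] (fun=> True).
case: i => [[[j|[i j]]|p]|p].
- by apply: lipschitz_on_mulmx => k; exact: lw.
- apply: lipschitz_onD; first exact: lipschitz_on_loop_linear.
  by apply: lipschitz_onZ; exact: lipschitz_on_mismatch.
- by apply: lipschitz_on_mulmx => k; exact: leps.
- apply: (@lipschitz_on_ext _ _ _ _ (fun Y => (A0 (ag (tag p)) *m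
      red_xi (assemble Y) (tag p)) (tagged p) 0 +
      f (st_x (assemble Y) (tag p)) (tagged p) 0)) => [Y|].
    by rewrite /loop_field /z_field mxE.
  apply: lipschitz_onD; first by apply: lipschitz_on_mulmx => k; exact: lxi.
  have [_ _ sf _] := ag_wf (tag p).
  have [L L0 LP] := smooth_lipschitz_box r sf.
  exists L => // Y Z e Yr Zr YZ; apply: LP => [||j].
  + by apply: assemble_st_x_box => ? ?; exact: Yr.
  + by apply: assemble_st_x_box => ? ?; exact: Zr.
  + by rewrite !assemble_st_x; exact: YZ.
Qed.

Lemma lipschitz_on_bound (Q : ix -> Prop) (phi : (ix -> R) -> R) :
  lipschitz_on setT Q phi ->
  exists2 L : R, 0 <= L & forall Y (r : R), 0 <= r ->
    (forall j, Q j -> `|Y j| <= r) -> `|phi Y| <= L * r + L.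
Proof.
move=> [L L0 LP]; exists (L + `|phi (fun=> 0)|) => [|Y r r0 Yr]; first exact: addr_ge0.
have := LP Y (fun=> 0) r I I.
have H : forall j, Q j -> `|Y j - 0| <= r by move=> j /Yr; rewrite subr0.
move=> /(_ H); have := ler_normD (phi Y - phi (fun=> 0)) (phi (fun=> 0)).
rewrite subrK mulrDl; have : 0 <= `|phi (fun=> 0)| * r by rewrite mulr_ge0.
lra.
Qed.

Lemma loop_field_linear_growth :
  exists2 L : R, 0 <= L & forall Y (r : R), (forall j, `|Y (inl j)| <= r) ->
    forall i, `|loop_field Y (inl i)| <= L * r + L.
Proof.
pose Q (i : ix) := exists j : I1, i = inl j.
have QP (Y : ix -> R) (r : R) : (forall j, `|Y (inl j)| <= r) -> forall j, Q j -> `|Y j| <= r.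
  by move=> Yr _ [j ->].
have [L L0 LP] : exists2 x, 0 <= x & forall i : I1, forall Y (r : R), 0 <= r ->
    (forall j, `|Y (inl j)| <= r) -> `|loop_field Y (inl i)| <= x * r + x.
  apply: (@finite_bound R I1 (fun i x => forall Y (r : R), 0 <= r ->
    (forall j, `|Y (inl j)| <= r) -> `|loop_field Y (inl i)| <= x * r + x)).
    move=> i x y xy H Y r r0 Yr; apply: (le_trans (H Y r r0 Yr)).
    by rewrite lerD// ler_wpM2r.
  case=> [[j|[i j]]|p] /=.
  - have [|L _ LP] := @lipschitz_on_bound Q (fun Y => (leader_S s *m st_w (assemble Y)) j 0).
      apply: lipschitz_on_mulmx => k.
      by have [+ _ _ _] := lipschitz_on_assemble setT Q; apply; eexists.
    by exists L => Y r r0 /QP; exact: LP.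
  - have [||L L0 LP] := lipschitz_on_bound (@lipschitz_on_loop_linear setT Q i j _ _).
    + by move=> k; exists (inl (inl k)).
    + by move=> i' k; exists (inl (inr (i', k))).
    have [M M0 MP] := g_lip i.
    exists (L + M * (nz (ag i))%:R) => Y r r0 Yr.
    have H1 := LP Y r r0 (QP _ _ Yr).
    have H2 := assemble_mismatch_le r0 (ltW M0) MP (fun k => Yr _).
    apply: (le_trans (ler_normD _ _)); rewrite normrM.
    have H3 : `|(j.+1 == nx (ag i))%:R : R| * `|g_mismatch (assemble Y) i| <=
        M * (nz (ag i))%:R * r.
      apply: le_trans H2; rewrite ler_piMl//.
      by case: eqP; rewrite ?normr1 ?normr0.
    have : 0 <= M * (nz (ag i))%:R by rewrite mulr_ge0// ltW.
    rewrite mulrDl; lra.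
  - have [|L _ LP] := @lipschitz_on_bound Q (fun Y => (A0 (ag (tag p)) *m
        (st_z (assemble Y) (tag p) - red_xi (assemble Y) (tag p))) (tagged p) 0).
      apply: lipschitz_on_mulmx => k.
      by have [_ _ + _] := lipschitz_on_assemble setT Q; apply; eexists.
    by exists L => Y r r0 /QP; exact: LP.
exists L => // Y r Yr i; apply: LP => //.
exact: le_trans (normr_ge0 _) (Yr i).
Qed.

(** The order of quantifiers matters: [L] comes from the matrices [A0] alone, while everything
    produced by [f] on the box of radius [r] goes into [B]. The rate [c] of [cascade_solution] needs
    [L] before [r] is known. *)
Lemma loop_field_driven_growth :
  exists2 L : R, 0 <= L & forall r : R, exists2 B : R, 0 <= B & forall Y (rho : R),
     (forall j, `|Y (inl j)| <= r) -> (forall j, `|Y (inr j)| <= rho) ->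
     forall i, `|loop_field Y (inr i)| <= L * rho + B.
Proof.
have [L L0 LP] : exists2 x, 0 <= x & forall i : I2, forall r : R, exists B : R,
    forall Y (rho : R), (forall j, `|Y (inl j)| <= r) -> (forall j, `|Y (inr j)| <= rho) ->
      `|loop_field Y (inr i)| <= x * rho + B.
  apply: (@finite_bound R I2 (fun i x => forall r : R, exists B : R,
    forall Y (rho : R), (forall j, `|Y (inl j)| <= r) -> (forall j, `|Y (inr j)| <= rho) ->
      `|loop_field Y (inr i)| <= x * rho + B)).
    move=> i x y xy H r; have [B BP] := H r; exists B => Y rho Yr Yrho.
    apply: (le_trans (BP Y rho Yr Yrho)); rewrite lerD2r ler_wpM2r//.
    exact: le_trans (normr_ge0 _) (Yrho i).
  move=> p /=.
  have [|L L0 LP] := @lipschitz_on_bound (fun i => exists j : I2, i = inr j)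
      (fun Y => (A0 (ag (tag p)) *m red_xi (assemble Y) (tag p)) (tagged p) 0).
    apply: lipschitz_on_mulmx => k.
    by have [_ _ _ +] := lipschitz_on_assemble setT (fun i : ix => exists j : I2, i = inr j);
      apply; eexists.
  exists L => r.
  have [_ _ sf _] := ag_wf (tag p).
  have [Lf Lf0 LfP] := smooth_lipschitz_box `|r| sf.
  (* The middle term bounds the variation of [f] from 0 to the current [x], both in the box of
     radius [|r|]. *)
  exists (L + Lf * `|r| + `|f (0 : 'cV_(nx (ag (tag p)))) (tagged p) 0|) => Y rho Yr Yrho.
  have rho0 : 0 <= rho := le_trans (normr_ge0 _) (Yrho p).
  have H1 : `|(A0 (ag (tag p)) *m red_xi (assemble Y) (tag p)) (tagged p) 0| <= L * rho + L.
    by apply: LP => // _ [j ->].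
  have b0 : box `|r| (0 : 'cV[R]_(nx (ag (tag p)))) by move=> j; rewrite mxE normr0.
  have bx : box `|r| (st_x (assemble Y) (tag p)).
    by apply: assemble_st_x_box => i j; exact: le_trans (Yr _) (ler_norm r).
  have H2 := LfP _ _ `|r| bx b0 _ (tagged p).
  have {H2} H2 : `|f (st_x (assemble Y) (tag p)) (tagged p) 0 -
      f (0 : 'cV_(nx (ag (tag p)))) (tagged p) 0| <= Lf * `|r|.
    apply: H2 => j; have -> : (0 : 'cV[R]_(nx (ag (tag p)))) j 0 = 0 by rewrite mxE.
    by rewrite subr0; exact: bx.
  rewrite mxE (le_trans (ler_normD _ _))//.
  have := ler_normD (f (st_x (assemble Y) (tag p)) (tagged p) 0 -
      f (0 : 'cV_(nx (ag (tag p)))) (tagged p) 0) (f (0 : 'cV_(nx (ag (tag p)))) (tagged p) 0).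
  rewrite subrK; lra.
exists L => // r.
(* A second pass over the indices, now with [L] and [r] fixed, makes [B] common to all of them. *)
have [B B0 BP] : exists2 B, 0 <= B & forall i : I2, forall Y (rho : R),
    (forall j, `|Y (inl j)| <= r) -> (forall j, `|Y (inr j)| <= rho) ->
      `|loop_field Y (inr i)| <= L * rho + B.
  apply: (@finite_bound R I2 (fun i B => forall Y (rho : R),
    (forall j, `|Y (inl j)| <= r) -> (forall j, `|Y (inr j)| <= rho) ->
      `|loop_field Y (inr i)| <= L * rho + B)).
    by move=> i x y xy H Y rho Yr Yrho; apply: (le_trans (H Y rho Yr Yrho)); rewrite lerD2l.
  by move=> i; exact: LP.
by exists B => // Y rho Yr Yrho i; exact: BP.
Qed.

End Existence.

Lemma continuous_coordP (R : realType) n (y : R -> 'cV[R]_n) :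
  (forall k, continuous (fun t => y t k 0)) -> continuous y.
Proof.
move=> cy t B [V nV VB].
have : \forall u \near t, forall k, V k 0 (y u k 0).
  apply: (@filter_forall R 'I_n (fun k u => V k 0 (y u k 0)) (nbhs t)) => k.
  exact: cy (nV k 0).
apply: filterS => u Vu; apply: VB => k j.
by rewrite ord1; exact: Vu.
Qed.

(** Picard iteration runs on the whole line; freezing [v] at its value at 0 on negative times leaves
    the equations at positive times unchanged. *)
Lemma continuous_halfline_extension (R : realType) (v : R -> R) :
  {within `[0, +oo[, continuous v} -> continuous (fun t : R => v (Num.max t 0)).
Proof.
move=> /subspace_continuousP cv t B nB.
have t0 : `[0, +oo[%classic (Num.max t 0).
  by rewrite /= in_itv /= andbT le_max lexx orbT.
have := @continuous_max0 R t _ (cv _ t0 B nB).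
apply: (@filterS _ (nbhs t)) => u; apply.
by rewrite /= in_itv /= andbT le_max lexx orbT.
Qed.

Lemma composite_trajectory_exists (R : realType) (N : nat) (ag : 'I_N -> agent R)
    (n0 : nat) (s : 'rV[R]_n0) (d0 : R) (a : 'M[R]_N.+1) (K : 'rV[R]_n0)
    (v : R -> R) (X0 : composite_state ag n0 (red_nc ag n0)) :
  (forall i, agent_wf (ag i)) -> (forall i, (nx (ag i) <= n0)%N) ->
  (forall i, g_lipschitz (ag i)) ->
  {within `[0, +oo[, continuous v} ->
  (exists2 l : R, 0 < l & forall t, 0 <= t -> `|v t| <= l) ->
  exists X, composite_trajectory s d0 (law := reduced_order_law ag s d0 a K) v X /\
    X 0 = X0.
Proof.
move=> wf nxle glip cv [l l0 vl].
have vl' (t : R) : `|v (Num.max t 0)| <= l by apply: vl; rewrite le_max lexx orbT.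
have [Y [Y0 cY dY]] := cascade_solution (@loop_input R N ag n0 d0) (coordinates X0)
  (continuous_halfline_extension cv) vl'
  (loop_field_linear_growth s d0 a K nxle glip)
  (loop_field_driven_growth s d0 a K wf nxle)
  (fun i r => let: ex_intro2 L L0 LP := lipschitz_on_loop_field s d0 a K wf nxle r i in
     ex_intro2 _ _ L L0 (fun Y Z e Yr Zr YZ => LP Y Z e Yr Zr (fun j _ => YZ j))).
pose X t : composite_state ag n0 (red_nc ag n0) := assemble (Y t).
exists X; split; last by rewrite /X Y0 coordinatesK.
have dw (t : R) j : 0 < t -> is_derive t 1 ((Y ^~ (ix_w ag j)))
    ((leader_S s *m st_w (X t)) j 0 + v t * leader_d n0 d0 j 0).
  by move=> t0; have := dY t (ix_w ag j) t0; rewrite /= max_l// ltW.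
have dx (t : R) i (j : 'I_n0) : 0 < t -> is_derive t 1 (Y ^~ (ix_xhat ag i j))
    (red_next s d0 a K i (v t) (X t) j.+1 + (j.+1 == nx (ag i))%:R * g_mismatch (X t) i).
  move=> t0; apply: is_derive_eq (dY t (ix_xhat ag i j) t0) _.
  by rewrite /= max_l ?(ltW t0)// red_nextE -/(X t); ring.
have deps (t : R) i k : 0 < t -> is_derive t 1 (Y ^~ (@ix_eps R N ag n0 i k))
    ((A0 (ag i) *m (st_z (X t) i - red_xi (X t) i)) k 0).
  by move=> t0; have := dY t (ix_eps n0 k) t0; rewrite /= mulr0 addr0.
have dxi (t : R) i k : 0 < t -> is_derive t 1 (Y ^~ (@ix_xi R N ag n0 i k))
    (z_field (red_xi (X t) i) (st_x (X t) i) k 0).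
  by move=> t0; have := dY t (ix_xi n0 k) t0; rewrite /= mulr0 addr0.
have xhE t i (j : 'I_n0) : red_xhat (X t) i j 0 = Y t (ix_xhat ag i j).
  by rewrite assemble_red_xhat// mxE.
have addE n (A B : 'cV[R]_n) k : (A + B) k 0 = A k 0 + B k 0 by rewrite mxE.
have oppE n (A : 'cV[R]_n) k : (- A) k 0 = - A k 0 by rewrite mxE.
have scaleE n r (A : 'cV[R]_n) k : (r *: A) k 0 = r * A k 0 by rewrite mxE.
split=> [i|i|i|]; split.
- apply: continuous_subspaceT; apply: continuous_coordP => k.
  under eq_fun do rewrite mxE.
  by move=> t; apply: cvgD; exact: cY.
- move=> t t0; apply/is_derive_coordP => k; under eq_fun do rewrite mxE.
  (* Since z = eps + xi, adding the two linear equations restores [A0 *m z], and [f] comes from the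
     observer. *)
  apply: is_derive_eq (is_deriveD (deps t i k t0) (dxi t i k t0)) _.
  by rewrite /z_field mulmxBr !addE oppE; ring.
- apply: continuous_subspaceT; apply: continuous_coordP => j.
  by under eq_fun do rewrite assemble_st_x; exact: cY.
- move=> t t0; apply/is_derive_coordP => j; under eq_fun do rewrite assemble_st_x.
  apply: is_derive_eq (dx t i _ t0) _; rewrite /= [RHS]mxE.
  have := ltn_ord j; rewrite leq_eqVlt => /orP[/eqP jx|jx].
    by rewrite jx ltnn eqxx mul1r /red_u /g_mismatch; ring.
  rewrite jx (ltn_eqF jx) mul0r addr0 /red_next (leq_trans jx)//.
  by rewrite ent_red_xhat// jx.
- apply: continuous_subspaceT; apply: continuous_coordP => k.
  rewrite -(splitK k); case: (fintype.split k) => k' /=.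
    by under eq_fun do rewrite col_mxEu mxE; exact: cY.
  have kx : (nx (ag i) + k' < n0)%N by rewrite -ltn_subRL.
  by under eq_fun do rewrite col_mxEd mxE (ent_lt _ kx) mxE; exact: cY.
- move=> t t0; apply/is_derive_coordP => k.
  rewrite -(splitK k); case: (fintype.split k) => k' /=.
    by rewrite col_mxEu; under eq_fun do rewrite col_mxEu mxE; exact: dxi.
  have kx : (nx (ag i) + k' < n0)%N by rewrite -ltn_subRL.
  rewrite col_mxEd mxE; under eq_fun do rewrite col_mxEd mxE (ent_lt _ kx) mxE.
  apply: is_derive_eq (dx t i _ t0) _; rewrite /=.
  by rewrite gtn_eqF ?mul0r ?addr0// ltnS leq_addr.
- apply: continuous_subspaceT; apply: continuous_coordP => k.
  by under eq_fun do rewrite mxE; exact: cY.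
- move=> t t0; apply/is_derive_coordP => k; under eq_fun do rewrite mxE.
  apply: is_derive_eq (dw t k t0) _.
  by rewrite /leader_field addE scaleE.
Qed.

Theorem theorem2 (R : realType) (N : nat) (ag : 'I_N -> agent R)
    (n0 : nat) (s : 'rV[R]_n0) (d0 : R) (a : 'M[R]_N.+1)
    (P : 'M[R]_n0) (gamma lambdaN : R)
    (Hag : forall i, agent_wf (ag i))
    (Hd0 : d0 != 0)
    (Ha : comm_graph a)
    (A1 : graph_connected a)
    (A2 : forall i, (nx (ag i) <= n0)%N)
    (A3 : forall i, g_lipschitz (ag i))
    (HP : posdef P)
    (HSP : let S := leader_S s in let d := leader_d n0 d0 in
       posdef (2%:R *: (P *m d *m d^T *m P) - (S^T *m P + P *m S)))
    (HlambdaN : smallest_eigenvalue (graph_H a) lambdaN)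
    (Hgamma : 1 / lambdaN <= gamma) :
  let K := - (gamma *: ((leader_d n0 d0)^T *m P)) in
  solves_coordination s d0 (reduced_order_law ag s d0 a K).
Proof.
move=> K v cv vl X0; split.
  exact: composite_trajectory_exists.
by move=> X traj _; apply: (tracking_error_cvg0 Hag Ha A1 A2 A3 HP HSP HlambdaN Hgamma traj).
Qed.
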